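(* Consider the group $\mathrm{SE}(2)$ of proper motions of the Euclidean plane with coordinates $(x,y,\theta)$, $x,y\in\mathbb{R}$, $\theta\in S^1=\mathbb{R}/2\pi\mathbb{Z}$, equipped with the left-invariant sub-Riemannian structure with orthonormal frame $$X_1=\cos\theta\,\frac{\partial}{\partial x}+\sin\theta\,\frac{\partial}{\partial y},\qquad X_2=\frac{\partial}{\partial\theta}.$$ Let $g:\mathbb{R}\to \mathrm{SE}(2)$ be a sub-Riemannian geodesic parametrized by arclength with $g(0)=\mathrm{Id}=(0,0,0)$. Then $g$ is homogeneous if and only if its image is one of the following two curves: (1) (''moving forward'') $\{(x,y,\theta)=(t,0,0)\mid t\in\mathbb{R}\}$; (2) (''turning in place'') $\{(x,y,\theta)=(0,0,t)\mid t\in\mathbb{R}\}$. Consequently, $\mathrm{SE}(2)$ with this sub-Riemannian structure is not geodesically orbital.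
   Context: $\mathrm{SE}(2)$ is the Lie group of matrices $$\begin{pmatrix}\cos\theta&-\sin\theta&x\\ \sin\theta&\cos\theta&y\\0&0&1\end{pmatrix},\qquad \theta\in S^1,\ x,y\in\mathbb{R},$$ and such a matrix is denoted $(x,y,\theta)$. A sub-Riemannian structure on a smooth manifold $M$ is a bracket-generating distribution with a smoothly varying inner product on it. A geodesic is a horizontal curve of constant speed whose sufficiently short arcs are length minimizers (shortest curves between their endpoints). $\mathrm{Isom}(M)$ is the group of isometries of the sub-Riemannian manifold $M$, i.e. diffeomorphisms preserving the distribution and the inner product on it. A sub-Riemannian geodesic, regarded as a subset $\gamma\subset M$ (its image), is called homogeneous if there is a one-parameter subgroup $\{\varphi_s\mid s\in\mathbb{R}\}\subset\mathrm{Isom}(M)$ such that: (i) $\varphi_s(\gamma)\subset\gamma$ for all $s\in\mathbb{R}$; (ii) for all $g_1,g_2\in\gamma$ there is $s\in\mathbb{R}$ with $\varphi_s(g_1)=g_2$. A sub-Riemannian manifold is called geodesically orbital if all its geodesics are homogeneous. *)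

(* Defs.v *)
(* MathComp / MathComp-Analysis *)
From mathcomp Require Import all_boot all_order all_algebra.
From mathcomp Require Import all_classical all_reals all_analysis.
Set Implicit Arguments.
Unset Strict Implicit.
Unset Printing Implicit Defensive.
Import Order.TTheory GRing.Theory Num.Theory.
Import numFieldNormedType.Exports.
Local Open Scope classical_set_scope.
Local Open Scope ring_scope.

Section Smoothness.
Context {R : realType}.

(* For finite-dimensional V, differentiability together with C^k directional
   derivatives in every direction is the usual notion of C^(k+1) map. *)
Fixpoint Ck {V W : normedModType R} (k : nat) (f : V -> W) : Prop :=
  if k is j.+1 then
    (forall x, differentiable f x) /\ (forall v, Ck j ('D_v f))
  else continuous f.

Definition Cinfty {V W : normedModType R} (f : V -> W) : Prop :=
  forall k, Ck k f.

End Smoothness.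

Section SE2.
Context {R : realType}.

Definition rigid_mx (p : R * R * R) : 'M[R]_3 :=
  let: (x, y, th) := p in
  \matrix_(i < 3, j < 3)
    nth 0 (nth [::] [:: [:: cos th; - sin th; x];
                        [:: sin th;   cos th; y];
                        [::      0;        0; 1]] i) j.

(* A set of matrices; used as a type, it is the subtype [set_type] with the
   topology induced by 'M[R]_3. *)
Definition SE2 : set 'M[R]_3 := range rigid_mx.

(* The element (x, y, theta), theta being read modulo 2 pi. This is a
   surjective local diffeomorphism R^3 -> SE(2), whose local inverses are the
   charts of SE(2). *)
Definition se2 (p : R * R * R) : SE2 :=
  exist _ (rigid_mx p) (mem_set (imageT rigid_mx p)).

(* Smoothness read in the charts of the source; the target SE(2) is an embedded
   submanifold of 'M[R]_3. *)
Definition smooth (phi : SE2 -> SE2) : Prop :=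
  Cinfty (fun p : R * R * R => set_val (phi (se2 p)) : 'M[R]_3).

Definition diffeomorphism (phi : SE2 -> SE2) : Prop :=
  exists psi : SE2 -> SE2,
    [/\ cancel phi psi, cancel psi phi, smooth phi & smooth psi].

(* Image under d phi of the vector w.1.1 d/dx + w.1.2 d/dy + w.2 d/dtheta at
   the point se2 p; tangent vectors of SE(2) are viewed as matrices. *)
Definition differential (phi : SE2 -> SE2) (p w : R * R * R) : 'M[R]_3 :=
  'D_w (fun p' : R * R * R => set_val (phi (se2 p')) : 'M[R]_3) p.

Definition tangent (p w : R * R * R) : 'M[R]_3 := differential id p w.

Definition X1 (p : R * R * R) : R * R * R := (cos p.2, sin p.2, 0).
Definition X2 (p : R * R * R) : R * R * R := (0, 0, 1).

Definition hvec (p : R * R * R) (u : R * R) : R * R * R :=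
  u.1 *: X1 p + u.2 *: X2 p.

Definition distribution (q : SE2) : set 'M[R]_3 :=
  [set v | exists p u, se2 p = q /\ v = tangent p (hvec p u)].

(* [inner q v w c]: v and w are horizontal at q and their inner product, for
   which X1, X2 is orthonormal, is c. *)
Definition inner (q : SE2) (v w : 'M[R]_3) (c : R) : Prop :=
  exists p u u', [/\ se2 p = q, v = tangent p (hvec p u),
    w = tangent p (hvec p u') & c = u.1 * u'.1 + u.2 * u'.2].

Definition sr_isometry (phi : SE2 -> SE2) : Prop :=
  [/\ diffeomorphism phi,
      forall p, [set differential phi p (hvec p u) | u in setT] =
                distribution (phi (se2 p)) &
      forall p v w c,
        inner (se2 p) (tangent p (hvec p v)) (tangent p (hvec p w)) c ->
        inner (phi (se2 p)) (differential phi p (hvec p v))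
                            (differential phi p (hvec p w)) c].

(* Continuity in (s, q) is continuity of s |-> phi s for the compact-open
   topology of the isometry group. *)
Definition one_parameter_subgroup (phi : R -> SE2 -> SE2) : Prop :=
  [/\ forall s, sr_isometry (phi s),
      phi 0 = id,
      forall s t, phi (s + t) = phi s \o phi t &
      continuous (fun sq : R * SE2 => phi sq.1 sq.2)].

Definition homogeneous (gamma : set SE2) : Prop :=
  exists phi : R -> SE2 -> SE2,
    [/\ one_parameter_subgroup phi,
        forall s, phi s @` gamma `<=` gamma &
        forall g1 g2, gamma g1 -> gamma g2 -> exists s, phi s g1 = g2].

(* On [a, b] the curve q is Lipschitz and satisfies
   q' = u1 X1(q) + u2 X2(q) almost everywhere, with measurable bounded u1, u2.
   The equation is written in integral form in coordinates (x, y, th), where th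
   is a lift of the angle from R/2piZ to R. *)
Definition horizontal (a b : R) (q : R -> SE2) (u1 u2 : R -> R) : Prop :=
  [/\ measurable_fun `[a, b] u1, measurable_fun `[a, b] u2,
      exists K : R, forall t, t \in `[a, b] -> `|u1 t| <= K /\ `|u2 t| <= K &
      exists x y th : R -> R, forall t, t \in `[a, b] ->
        [/\ q t = se2 (x t, y t, th t),
            x t = x a + \int[lebesgue_measure]_(s in `[a, t]) (u1 s * cos (th s)),
            y t = y a + \int[lebesgue_measure]_(s in `[a, t]) (u1 s * sin (th s)) &
            th t = th a + \int[lebesgue_measure]_(s in `[a, t]) u2 s]].

Definition speed (u1 u2 : R -> R) (t : R) : R :=
  Num.sqrt (u1 t ^+ 2 + u2 t ^+ 2).

Definition length (a b : R) (u1 u2 : R -> R) : R :=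
  \int[lebesgue_measure]_(t in `[a, b]) speed u1 u2 t.

(* The controls of a horizontal curve are unique up to a null set, so the
   length does not depend on their choice. *)
Definition minimizer (a b : R) (q : R -> SE2) : Prop :=
  (exists u1 u2, horizontal a b q u1 u2) /\
  forall u1 u2, horizontal a b q u1 u2 ->
  forall (a' b' : R) (q' : R -> SE2) (v1 v2 : R -> R), a' <= b' ->
    horizontal a' b' q' v1 v2 -> q' a' = q a -> q' b' = q b ->
    length a b u1 u2 <= length a' b' v1 v2.

Definition geodesic_of_speed (c : R) (q : R -> SE2) : Prop :=
  (exists u1 u2 : R -> R,
     (forall a b : R, a <= b -> horizontal a b q u1 u2) /\
     {ae lebesgue_measure, forall t, speed u1 u2 t = c}) /\
  (forall t, exists2 e : R, 0 < e &
     forall a b : R, t - e < a -> a <= b -> b < t + e -> minimizer a b q).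

Definition geodesic (q : R -> SE2) : Prop :=
  exists2 c : R, 0 <= c & geodesic_of_speed c q.

Definition arclength_geodesic (q : R -> SE2) : Prop := geodesic_of_speed 1 q.

End SE2.

Arguments SE2 R : clear implicits.

Definition geodesically_orbital (R : realType) : Prop :=
  forall q : R -> SE2 R, geodesic q -> homogeneous (range q).

(* Main.v *)
Require Import Defs.
From mathcomp Require Import all_boot all_order all_algebra.
From mathcomp Require Import all_classical all_reals all_analysis.
From mathcomp Require Import ring lra measurable_realfun.
Set Implicit Arguments.
Unset Strict Implicit.
Unset Printing Implicit Defensive.
Import Order.TTheory GRing.Theory Num.Theory.
Import numFieldNormedType.Exports.
Local Open Scope classical_set_scope.
Local Open Scope ring_scope.

(** An isometry pulls the Maurer-Cartan coframe back to a coframe whose matrix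
    in [X1], [X2] is orthogonal; the structure equations [X1, X2] = X3,
    [X2, X3] = X1, [X1, X3] = 0 force this matrix to be diagonal with constant
    entries of square 1.  Hence the square of an isometry is a left
    translation, and so is every member of a one-parameter group of isometries.
    The image of a homogeneous geodesic through the identity is therefore an
    abelian subgroup.  If it contains only translations, horizontality makes it
    the x-axis.  Otherwise it consists of rotations about a common centre, and
    horizontality puts the centre at some (0, r); when r <> 0 an explicit
    competitor between two points of the circle is strictly shorter, so r = 0.
    Finally the tractrix through the identity is a geodesic of neither kind: it
    is an integral curve of the horizontal gradient of f = - y + sin theta,
    which has norm 1 everywhere and so calibrates its integral curves. *)

(** * Primitives of bounded measurable functions *)

(** Controls are only bounded and measurable, so the equations of a horizontal curve are in integral
    form: composing a lift of the angle with [sin] or [cos] takes a chain rule for Lipschitz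
    primitives, and controls are recovered from a curve only almost everywhere, by Lebesgue
    differentiation. Angles are determined modulo 2 pi and lifts are given on one compact interval
    at a time, so points are compared through [cos] and [sin]. No geodesic equation is derived: for
    a homogeneous geodesic, minimality serves only to show that a short arc does not return to its
    start and admits no shortcut. The whole axis is then filled from one initial arc, since a
    subgroup of R containing an interval is R. In the study of isometries the image of X3 is a
    priori an arbitrary vector; its components along X1 and X2 are unknowns that the brackets
    eliminate. The function f is found by solving (X1 f)^2 + (X2 f)^2 = 1 with the ansatz - y +
    h(theta), which leaves h'^2 = cos^2. *)

Section BoundedMeasurable.
Context {R : realType}.
Notation mu := (@lebesgue_measure R).
Implicit Types (a b s t : R) (u v w th : R -> R).

Definition bounded_measurable a b v :=
  measurable_fun `[a, b] v /\
  exists K : R, forall t, t \in `[a, b] -> `|v t| <= K.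

Lemma bounded_measurableS a b s t v : a <= s -> t <= b ->
  bounded_measurable a b v -> bounded_measurable s t v.
Proof.
move=> as_ tb [mv [K vK]]; have sub : `[s, t] `<=` `[a, b].
  by apply: subset_itv; rewrite bnd_simp.
split; first exact: measurable_funS mv.
by exists K => x xst; apply: vK; move: (sub x xst).
Qed.

Lemma bounded_measurableD a b v w : bounded_measurable a b v ->
  bounded_measurable a b w -> bounded_measurable a b (fun t => v t + w t).
Proof.
move=> [mv [K vK]] [mw [L wL]]; split; first exact: measurable_funD.
by exists (K + L) => t tab; rewrite (le_trans (ler_normD _ _))// lerD ?vK ?wL.
Qed.

Lemma bounded_measurableM a b v w : bounded_measurable a b v ->
  bounded_measurable a b w -> bounded_measurable a b (fun t => v t * w t).
Proof.
move=> [mv [K vK]] [mw [L wL]]; split; first exact: measurable_funM.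
by exists (K * L) => t tab; rewrite normrM ler_pM ?vK ?wL.
Qed.

Lemma bounded_measurable_cst a b c : bounded_measurable a b (fun=> c).
Proof. by split; [exact: measurable_cst|exists `|c|]. Qed.

Lemma bounded_measurableB a b v w : bounded_measurable a b v ->
  bounded_measurable a b w -> bounded_measurable a b (fun t => v t - w t).
Proof.
move=> [mv [K vK]] [mw [L wL]]; split; first exact: measurable_funB.
by exists (K + L) => t tab; rewrite (le_trans (ler_normB _ _))// lerD ?vK ?wL.
Qed.

Lemma bounded_measurable_norm a b v : bounded_measurable a b v ->
  bounded_measurable a b (fun t => `|v t|).
Proof.
move=> [mv [K vK]]; split; first exact: measurableT_comp.
by exists K => t tab; rewrite normr_id vK.
Qed.

Lemma bounded_measurable_comp a b (f : R -> R) th : continuous f ->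
  (exists K : R, forall x, `|f x| <= K) -> {within `[a, b], continuous th} ->
  bounded_measurable a b (fun t => f (th t)).
Proof.
move=> cf [K fK] cth; split; last by exists K.
apply: measurableT_comp; first exact: continuous_measurable_fun.
exact: subspace_continuous_measurable_fun.
Qed.

Lemma bounded_measurable_continuous a b v : continuous v ->
  bounded_measurable a b v.
Proof.
move=> cv; split.
  by apply: measurable_funTS; exact: continuous_measurable_fun.
have [ab|ba] := leP a b; last first.
  by exists 0 => t; rewrite in_itv/= => /andP[/le_trans h /h]; rewrite leNgt ba.
have cwv : {within `[a, b], continuous (fun t => `|v t|)}.
  by apply: continuous_subspaceT => x; apply: continuous_comp (cv x) _; exact: norm_continuous.
have [c _ hc] := EVT_max ab cwv.
by exists `|v c|.
Qed.

Lemma bounded_measurable_sqrt a b v : (forall t, 0 <= v t) ->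
  bounded_measurable a b v ->
  bounded_measurable a b (fun t => Num.sqrt (v t)).
Proof.
move=> v0 [mv [K vK]]; split.
  by apply: measurableT_comp => //; apply: continuous_measurable_fun; exact: sqrt_continuous.
exists (Num.sqrt K) => t tab.
by rewrite ger0_norm ?sqrtr_ge0// ler_wsqrtr// (le_trans _ (vK t tab))// ler_norm.
Qed.

Lemma bounded_measurable_integrable a b v : bounded_measurable a b v ->
  mu.-integrable `[a, b] (EFin \o v).
Proof.
move=> [mv [K vK]]; apply: measurable_bounded_integrable => //.
- by rewrite /= lebesgue_measure_itv/=; case: ifPn => // _; rewrite -EFinB ltry.
- exists `|K|; split; first by rewrite num_real.
  move=> x Kx t /= tab; rewrite (le_trans (vK t tab))// (le_trans (ler_norm K))//.
  exact: ltW.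
Qed.

Lemma RintegralD_itv a s t v : a <= s -> s <= t -> bounded_measurable a t v ->
  \int[mu]_(x in `[a, t]) v x =
  \int[mu]_(x in `[a, s]) v x + \int[mu]_(x in `[s, t]) v x.
Proof.
move=> as_ st bv; have iv := bounded_measurable_integrable bv.
have := @Rintegral_itvB R v (BLeft a) (BRight t) s iv.
rewrite !bnd_simp => /(_ as_ st) h.
apply/eqP; rewrite addrC -subr_eq h; apply/eqP.
rewrite Rintegral_itv_obnd_cbnd//; apply: integrableS iv => //.
by apply: subset_itv; rewrite bnd_simp.
Qed.

Lemma Rintegral_itv_bound s t v (K : R) : s <= t -> bounded_measurable s t v ->
  (forall x, x \in `[s, t] -> `|v x| <= K) ->
  `|\int[mu]_(x in `[s, t]) v x| <= K * (t - s).
Proof.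
move=> st bv vK; have iv := bounded_measurable_integrable bv.
rewrite (le_trans (le_normr_Rintegral _ iv))//.
have muE : fine (mu `[s, t]) = t - s.
  rewrite lebesgue_measure_itv/= lte_fin.
  by move: st; rewrite le_eqVlt => /predU1P[->|->//]; rewrite ltxx subrr.
rewrite -muE -Rintegral_cst//; apply: le_Rintegral => //.
- exact: (bounded_measurable_integrable (bounded_measurable_norm bv)).
- exact: (bounded_measurable_integrable (bounded_measurable_cst _ _ _)).
Qed.

Lemma RintegralD_bm a b v w : bounded_measurable a b v ->
  bounded_measurable a b w ->
  \int[mu]_(x in `[a, b]) (v x + w x) =
  \int[mu]_(x in `[a, b]) v x + \int[mu]_(x in `[a, b]) w x.
Proof. by move=> /bounded_measurable_integrable iv /bounded_measurable_integrable iw; exact: RintegralD. Qed.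

Lemma RintegralB_bm a b v w : bounded_measurable a b v ->
  bounded_measurable a b w ->
  \int[mu]_(x in `[a, b]) (v x - w x) =
  \int[mu]_(x in `[a, b]) v x - \int[mu]_(x in `[a, b]) w x.
Proof. by move=> /bounded_measurable_integrable iv /bounded_measurable_integrable iw; exact: RintegralB. Qed.

Lemma RintegralZ_bm a b c v : bounded_measurable a b v ->
  \int[mu]_(x in `[a, b]) (c * v x) = c * \int[mu]_(x in `[a, b]) v x.
Proof. by move=> /bounded_measurable_integrable iv; exact: RintegralZl. Qed.

Lemma le_Rintegral_bm a b v w : bounded_measurable a b v ->
  bounded_measurable a b w -> (forall t, t \in `[a, b] -> v t <= w t) ->
  \int[mu]_(x in `[a, b]) v x <= \int[mu]_(x in `[a, b]) w x.
Proof. by move=> /bounded_measurable_integrable iv /bounded_measurable_integrable iw ?; exact: le_Rintegral. Qed.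

Lemma Rintegral_itv1 a v : \int[mu]_(x in `[a, a]) v x = 0.
Proof. by rewrite set_itv1 Rintegral_set1. Qed.

Lemma Rintegral_itv_cst a b c : a <= b -> \int[mu]_(x in `[a, b]) c = c * (b - a).
Proof.
move=> ab; rewrite Rintegral_cst//=.
rewrite lebesgue_measure_itv/= lte_fin.
by move: ab; rewrite le_eqVlt => /predU1P[->|->//]; rewrite ltxx subrr.
Qed.

(* Bisecting [n] times improves the constant [C] to [C / 2 ^ n]. *)
Lemma quadratic_increment_constant a b (D : R -> R) (C : R) :
  (forall s t, a <= s -> s <= t -> t <= b -> `|D t - D s| <= C * (t - s) ^+ 2) ->
  forall t, t \in `[a, b] -> D t = D a.
Proof.
move=> DC t; rewrite in_itv/= => /andP[at_ tb].
have bis n : forall s t, a <= s -> s <= t -> t <= b ->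
    `|D t - D s| <= C * (t - s) ^+ 2 / 2 ^+ n.
  elim: n => [|n IH] {at_ tb t} s t as_ st tb.
    by rewrite expr0 divr1; exact: DC.
  pose m := (s + t) / 2.
  have [sm mt] : s <= m /\ m <= t by rewrite /m; split; lra.
  have -> : D t - D s = (D t - D m) + (D m - D s) by ring.
  rewrite (le_trans (ler_normD _ _))//.
  have h1 := IH m t (le_trans as_ sm) mt tb.
  have h2 := IH s m as_ sm (le_trans mt tb).
  apply: le_trans (lerD h1 h2) _.
  have -> : C * (t - m) ^+ 2 / 2 ^+ n + C * (m - s) ^+ 2 / 2 ^+ n =
            C * (t - s) ^+ 2 / 2 ^+ n.+1.
    rewrite /m [2 ^+ n.+1]exprS; set q := 2 ^+ n; have : q != 0 by rewrite expf_neq0.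
    by move=> q0; field.
  by [].
apply/eqP; rewrite -subr_eq0 -normr_le0; apply/ler_addgt0Pr => e e0.
rewrite add0r; set M := C * (t - a) ^+ 2.
have Mge0 : 0 <= M by exact: le_trans (DC a t _ at_ tb).
have [n hn] : exists n : nat, M / e < n%:R.
  exists (Num.truncn (M / e)).+1; exact: truncnS_gt.
apply: le_trans (bis n a t (lexx _) at_ tb) _; rewrite -/M.
have h2 : (n%:R : R) < 2 ^+ n by rewrite -natrX ltr_nat ltn_expl.
rewrite ler_pdivrMr ?exprn_gt0// mulrC.
by rewrite -ler_pdivrMr// ltW// (lt_trans hn).
Qed.

Lemma primitive_continuous a b v th : a <= b -> bounded_measurable a b v ->
  (forall t, t \in `[a, b] -> th t = th a + \int[mu]_(x in `[a, t]) v x) ->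
  {within `[a, b], continuous th}.
Proof.
move=> ab bv thE.
have := parameterized_integral_continuous ab (bounded_measurable_integrable bv).
move=> c; pose f := fun t => th a + parameterized_integral mu a t v.
have : {within `[a, b], continuous f}.
  by move=> x; apply: cvgD; [exact: cvg_cst|exact: c].
apply: subspace_eq_continuous => x; rewrite inE/= => xab.
exact/esym/(thE x xab).
Qed.

Lemma primitive_increment a b v th s t : bounded_measurable a b v ->
  (forall t, t \in `[a, b] -> th t = th a + \int[mu]_(x in `[a, t]) v x) ->
  a <= s -> s <= t -> t <= b -> th t - th s = \int[mu]_(x in `[s, t]) v x.
Proof.
move=> bv thE as_ st tb.
rewrite thE ?in_itv/= ?(le_trans as_)// [th s]thE ?in_itv/= ?as_ ?(le_trans st)//.
rewrite (@RintegralD_itv a s t)//; first by ring.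
by apply: bounded_measurableS bv.
Qed.

(** The lift [th] is only Lipschitz, so the difference of the two sides is not differentiated. Its
    increments are shown to be quadratic in the length of the interval, which forces it to be
    constant. *)
Lemma chain_rule_primitive (G G' : R -> R) (M : R) a b v th : a <= b ->
  (forall x : R, is_derive x 1 G (G' x)) -> continuous G' ->
  (forall x : R, `|G' x| <= M) -> (forall x y : R, `|G' x - G' y| <= M * `|x - y|) ->
  bounded_measurable a b v ->
  (forall t, t \in `[a, b] -> th t = th a + \int[mu]_(x in `[a, t]) v x) ->
  forall t, t \in `[a, b] ->
    G (th t) = G (th a) + \int[mu]_(x in `[a, t]) (v x * G' (th x)).
Proof.
move=> ab dG cG' bG' lG' bv thE.
have cth := primitive_continuous ab bv thE.
have bG'th : bounded_measurable a b (fun t => G' (th t)).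
  by apply: bounded_measurable_comp => //; exists M.
have bvG := bounded_measurableM bv bG'th.
have [_ [K vK]] := bv.
have M0 : 0 <= M by apply: le_trans (bG' 0).
have K0 : 0 <= K by apply: le_trans (vK a _) => //; rewrite in_itv/= lexx.
pose D t := G (th t) - \int[mu]_(x in `[a, t]) (v x * G' (th x)).
have thL s t : a <= s -> s <= t -> t <= b -> `|th t - th s| <= K * (t - s).
  move=> as_ st tb; rewrite (primitive_increment bv thE)//.
  apply: Rintegral_itv_bound => //; first exact: bounded_measurableS bv.
  by move=> x; rewrite in_itv/= => /andP[sx xt]; apply: vK; rewrite in_itv/= (le_trans as_)// (le_trans xt).
(* Mean value theorem without an order between [x] and [y]; only the distance from [c] to [x] is
   needed afterwards. *)
have GT x y : exists2 c, `|c - x| <= `|y - x| & G y - G x = G' c * (y - x).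
  have cG : continuous G by move=> z; apply: differentiable_continuous; apply/derivable1_diffP; exact: ex_derive.
  have [xy|yx] := leP x y.
    have [|c] := @MVT_segment R G G' x y xy (fun z _ => dG z).
      exact: continuous_subspaceT.
    rewrite in_itv/= => /andP[xc cy] e; exists c => //.
    by rewrite !ger0_norm ?subr_ge0// lerD2r.
  have [|c] := @MVT_segment R G G' y x (ltW yx) (fun z _ => dG z).
    exact: continuous_subspaceT.
  rewrite in_itv/= => /andP[xc cy] e; exists c => //.
    by rewrite distrC [leRHS]distrC !ger0_norm ?subr_ge0// ?(ltW yx)// lerD2l lerN2.
  by rewrite -opprB e; ring.
(* Both [c] and [th x] lie within [K * (t - s)] of [th s], so the two values of [G'] differ by at
   most [2 * M * K * (t - s)]. The factor [v], bounded by [K], and the length of the interval supply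
   the rest. *)
have DC s t : a <= s -> s <= t -> t <= b ->
    `|D t - D s| <= (2 * M * K ^+ 2) * (t - s) ^+ 2.
  move=> as_ st tb.
  have bvst : bounded_measurable s t v by exact: bounded_measurableS bv.
  have bvGst : bounded_measurable s t (fun t => v t * G' (th t)) by exact: bounded_measurableS bvG.
  have -> : D t - D s = (G (th t) - G (th s)) -
      \int[mu]_(x in `[s, t]) (v x * G' (th x)).
    rewrite /D (@RintegralD_itv a s t) //; first by ring.
    exact: bounded_measurableS bvG.
  have [c cs ->] := GT (th s) (th t).
  have -> : G' c * (th t - th s) = \int[mu]_(x in `[s, t]) (G' c * v x).
    by rewrite RintegralZ_bm// (primitive_increment bv thE).
  rewrite -RintegralB_bm//; last first.
    by apply: bounded_measurableM => //; exact: bounded_measurable_cst.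
  rewrite (_ : 2 * M * K ^+ 2 * (t - s) ^+ 2 = (2 * M * K ^+ 2 * (t - s)) * (t - s)); last by ring.
  apply: Rintegral_itv_bound => //.
    apply: bounded_measurableB => //.
    by apply: bounded_measurableM => //; exact: bounded_measurable_cst.
  move=> x; rewrite in_itv/= => /andP[sx xt].
  have -> : G' c * v x - v x * G' (th x) = (G' c - G' (th x)) * v x by ring.
  rewrite normrM.
  have -> : 2 * M * K ^+ 2 * (t - s) = (M * (2 * (K * (t - s)))) * K by ring.
  apply: ler_pM => //; last by apply: vK; rewrite in_itv/= (le_trans as_)// (le_trans xt).
  apply: le_trans (lG' _ _) _; apply: ler_wpM2l => //.
  have -> : c - th x = (c - th s) - (th x - th s) by ring.
  apply: le_trans (ler_normB _ _) _.
  have h1 := le_trans cs (thL s t as_ st tb).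
  have h2 := thL s x as_ sx (le_trans xt tb).
  have h3 : K * (x - s) <= K * (t - s) by rewrite ler_wpM2l// lerD2r.
  by move: h1 h2 h3; lra.
move=> t tab; have := quadratic_increment_constant DC tab.
by rewrite /D Rintegral_itv1 subr0 => <-; ring.
Qed.

Lemma sin_lipschitz (x y : R) : `|sin x - sin y| <= 1 * `|x - y|.
Proof.
wlog xy : x y / x <= y.
  move=> H; have [|/ltW] := leP x y; first exact: H.
  by rewrite distrC [`|x - y|]distrC; exact: H.
have [|c _ e] := @MVT_segment R sin cos x y xy (fun z _ => is_derive_sin z).
  by apply: continuous_subspaceT; exact: continuous_sin.
by rewrite distrC e normrM [`|y - x|]distrC ler_wpM2r// cos_max.
Qed.

Lemma cos_lipschitz (x y : R) : `|cos x - cos y| <= 1 * `|x - y|.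
Proof.
wlog xy : x y / x <= y.
  move=> H; have [|/ltW] := leP x y; first exact: H.
  by rewrite distrC [`|x - y|]distrC; exact: H.
have [|c _ e] := @MVT_segment R cos (fun z => - sin z) x y xy (fun z _ => is_derive_cos z).
  by apply: continuous_subspaceT; exact: continuous_cos.
by rewrite distrC e normrM [`|y - x|]distrC ler_wpM2r// normrN sin_max.
Qed.

Lemma sin_primitive a b v th : a <= b -> bounded_measurable a b v ->
  (forall t, t \in `[a, b] -> th t = th a + \int[mu]_(x in `[a, t]) v x) ->
  forall t, t \in `[a, b] ->
    sin (th t) = sin (th a) + \int[mu]_(x in `[a, t]) (v x * cos (th x)).
Proof.
move=> ab; apply: (@chain_rule_primitive sin cos 1) => //.
- exact: continuous_cos.
- exact: cos_max.
- exact: cos_lipschitz.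
Qed.

Lemma cos_primitive a b v th : a <= b -> bounded_measurable a b v ->
  (forall t, t \in `[a, b] -> th t = th a + \int[mu]_(x in `[a, t]) v x) ->
  forall t, t \in `[a, b] ->
    cos (th t) = cos (th a) + \int[mu]_(x in `[a, t]) (v x * - sin (th x)).
Proof.
move=> ab; apply: (@chain_rule_primitive cos (fun x => - sin x) 1) => //.
- by move=> x; apply: cvgN; exact: continuous_sin.
- by move=> x; rewrite normrN sin_max.
- by move=> x y; rewrite -opprD normrN; exact: sin_lipschitz.
Qed.

(** Lebesgue differentiation: almost everywhere the integrand is the derivative of its primitive,
    here zero near every interior point. This is how controls are read off a curve. *)
Lemma ae_eq0_of_primitive a b v : a < b -> bounded_measurable a b v ->
  (forall t, t \in `[a, b] -> \int[mu]_(x in `[a, t]) v x = 0) ->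
  {ae mu, forall t, t \in `]a, b[ -> v t = 0}.
Proof.
move=> ab bv v0; have iv := bounded_measurable_integrable bv.
(* Extension by zero, because the differentiation theorem asks for a locally integrable function on
   the whole line. *)
pose f := v \_ `[a, b].
have loc : locally_integrable setT f by exact: integrable_locally.
have intf : forall y, mu.-integrable `[a, y] (EFin \o f).
  move=> y; have : mu.-integrable setT (EFin \o f).
    by rewrite -restrict_EFin; apply/integrable_restrict => //; rewrite setTI.
  by apply: integrableS.
have := @FTC1 R f (BLeft a) intf loc.
apply: filterS; first exact: (ae_filter_ringOfSetsType mu).
move=> t /= h tab.
move: (tab); rewrite in_itv/= => /andP[at_ tb].
have -> : v t = f t by rewrite /f patchE ifT// inE/= in_itv/= !ltW.
have [|_ <-] := h; first by rewrite lte_fin.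
rewrite derive1E.
rewrite (@near_eq_derive _ _ _ _ (fun=> 0)) ?derive_cst ?oner_eq0//.
near=> y.
have yab : y \in `]a, b[ by near: y; apply: near_in_itvoo.
move: (yab); rewrite in_itv/= => /andP[ay yb].
rewrite -(v0 y); last by rewrite in_itv/= !ltW.
apply: eq_Rintegral => x; rewrite inE/= in_itv/= => /andP[ax xy].
by rewrite /f patchE ifT// inE/= in_itv/= ax (le_trans xy)// ltW.
Unshelve. all: by end_near. Qed.

Lemma primitive_of_derivative a b (F f : R -> R) : a <= b ->
  (forall x : R, is_derive x 1 F (f x)) -> continuous f ->
  forall t, t \in `[a, b] -> F t = F a + \int[mu]_(x in `[a, t]) f x.
Proof.
move=> ab dF cf t; rewrite in_itv/= => /andP[at_ tb].
move: at_; rewrite le_eqVlt => /predU1P[<-|at_]; first by rewrite Rintegral_itv1 addr0.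
have cF : continuous F by move=> z; apply: differentiable_continuous; apply/derivable1_diffP; exact: ex_derive.
rewrite /Rintegral (@continuous_FTC2 _ f F)//=; first by ring.
- exact: continuous_subspaceT.
- by split=> //; [apply: cvg_at_right_filter; exact: cF|apply: cvg_at_left_filter; exact: cF].
- by move=> x _; rewrite derive1E derive_val.
Qed.

End BoundedMeasurable.

(** * The tractrix is a geodesic *)

Section AlmostEverywhere.
Context {R : realType}.
Notation mu := (@lebesgue_measure R).
Implicit Types (a b : R) (v w : R -> R).

(** The hypothesis concerns the open interval, which is what [ae_eq0_of_primitive] provides; the two
    end points form a null set. *)
Lemma eq_Rintegral_ae a b v w : bounded_measurable a b v ->
  bounded_measurable a b w -> {ae mu, forall t, t \in `]a, b[ -> v t = w t} ->
  \int[mu]_(x in `[a, b]) v x = \int[mu]_(x in `[a, b]) w x.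
Proof.
move=> bv bw vw.
have iv := bounded_measurable_integrable bv.
have iw := bounded_measurable_integrable bw.
have sub : `]a, b[ `<=` `[a, b] by apply: subset_itv; rewrite bnd_simp.
have [ab|ba] := ltP a b; last first.
  move: ba; rewrite le_eqVlt => /predU1P[->|ba]; first by rewrite !Rintegral_itv1.
  by rewrite set_itv_ge ?Rintegral_set0// bnd_simp -ltNge.
have E f : bounded_measurable a b f ->
    \int[mu]_(x in `[a, b]) f x = \int[mu]_(x in `]a, b[) f x.
  move=> /bounded_measurable_integrable fi.
  rewrite Rintegral_itv_obnd_cbnd; last by apply: integrableS fi.
  rewrite -Rintegral_itv_bndo_bndc//; apply: integrableS fi => //.
  by apply: subset_itv; rewrite bnd_simp.
rewrite !E//; congr fine; apply: ae_eq_integral => //.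
- by apply: measurable_int; apply: integrableS iv.
- by apply: measurable_int; apply: integrableS iw.
- apply: filterS vw; first exact: (ae_filter_ringOfSetsType mu).
  by move=> x h xab /=; rewrite h.
Qed.

End AlmostEverywhere.

(** * Coordinates on SE(2), the angle modulo 2 pi *)

Section Coordinates.
Context {R : realType}.
Implicit Types (p q : R * R * R) (M : SE2 R).

Lemma se2E p : set_val (se2 p) = rigid_mx p. Proof. by []. Qed.

Lemma rigid_mxE p :
  [/\ rigid_mx p 0 0 = cos p.2, rigid_mx p 1 0 = sin p.2,
      rigid_mx p 0 2 = p.1.1 & rigid_mx p 1 2 = p.1.2].
Proof. by case: p => -[x y] th; rewrite !mxE. Qed.

(** The angle enters only through [cos] and [sin], so equality in SE(2) never requires choosing a
    representative modulo 2 pi. *)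
Lemma se2_eqP p q : se2 p = se2 q <->
  [/\ cos p.2 = cos q.2, sin p.2 = sin q.2, p.1.1 = q.1.1 & p.1.2 = q.1.2].
Proof.
split=> [/(congr1 set_val)|].
  rewrite !se2E; have [<- <- <- <-] := rigid_mxE p.
  by have [<- <- <- <-] := rigid_mxE q => ->.
case: p q => -[x y] th [[x' y'] th']/= [e1 e2 e3 e4].
by apply: val_inj; rewrite /= e1 e2 e3 e4.
Qed.

Lemma se2_surj M : exists p, M = se2 p.
Proof.
case: M => m mM; have [p _ pm] := set_mem mM; exists p.
exact/val_inj/esym.
Qed.

End Coordinates.

(** * The calibration inequality *)

Section Horizontal.
Context {R : realType}.
Notation mu := (@lebesgue_measure R).
Implicit Types (a b : R) (q : R -> SE2 R).

Lemma horizontal_controls a b q (u1 u2 : R -> R) : horizontal a b q u1 u2 ->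
  bounded_measurable a b u1 /\ bounded_measurable a b u2.
Proof.
case=> m1 m2 [K uK] _; split; split=> //; exists K => t tab; by case: (uK t tab).
Qed.

Lemma bounded_measurable_speed a b (u1 u2 : R -> R) : bounded_measurable a b u1 ->
  bounded_measurable a b u2 -> bounded_measurable a b (speed u1 u2).
Proof.
move=> b1 b2; apply: bounded_measurable_sqrt.
  by move=> t; rewrite addr_ge0 ?sqr_ge0.
by apply: bounded_measurableD; exact: bounded_measurableM.
Qed.

(* [f = - y + sin th] has [X1 f = - sin th] and [X2 f = cos th], so its
   horizontal gradient has norm 1 everywhere: it calibrates its integral curves. *)
Definition calibration (M : SE2 R) : R := - set_val M 1 2 + set_val M 1 0.

Lemma calibration_se2 p : calibration (se2 p) = - p.1.2 + sin p.2.
Proof. by rewrite /calibration se2E; have [_ -> _ ->] := rigid_mxE p. Qed.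

(** By the chain rule the increment of f is the integral of [u2 * cos th - u1 * sin th], the scalar
    product of the control with a unit vector. *)
Lemma calibration_le_length a b q (u1 u2 : R -> R) : a <= b -> horizontal a b q u1 u2 ->
  calibration (q b) - calibration (q a) <= length a b u1 u2.
Proof.
move=> ab hor; have [b1 b2] := horizontal_controls hor.
case: hor => _ _ _ [x [y [th h]]].
have aab : a \in `[a, b] by rewrite in_itv/= lexx.
have bab : b \in `[a, b] by rewrite in_itv/= lexx andbT.
have thE t : t \in `[a, b] -> th t = th a + \int[mu]_(s in `[a, t]) u2 s.
  by move=> /h[].
have cth := primitive_continuous ab b2 thE.
have bc : bounded_measurable a b (fun t => cos (th t)).
  by apply: bounded_measurable_comp => //; [exact: continuous_cos|exists 1; exact: cos_max].
have bs : bounded_measurable a b (fun t => sin (th t)).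
  by apply: bounded_measurable_comp => //; [exact: continuous_sin|exists 1; exact: sin_max].
have b1s := bounded_measurableM b1 bs; have b2c := bounded_measurableM b2 bc.
have [qb _ yb _] := h b bab; have [qa _ _ _] := h a aab.
rewrite qa qb !calibration_se2/= yb (sin_primitive ab b2 thE bab).
rewrite (_ : _ - _ = \int[mu]_(x in `[a, b]) (u2 x * cos (th x)) -
  \int[mu]_(s in `[a, b]) (u1 s * sin (th s))); last by ring.
rewrite -RintegralB_bm//; apply: le_Rintegral_bm.
- exact: bounded_measurableB.
- exact: bounded_measurable_speed.
- move=> t _; apply: le_trans (ler_norm _) _.
  rewrite -sqrtr_sqr ler_wsqrtr//.
  (* Cauchy-Schwarz through the decomposition of the control in a rotated orthonormal basis. *)
  rewrite (_ : _ + _ = (u2 t * cos (th t) - u1 t * sin (th t)) ^+ 2 +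
     (u2 t * sin (th t) + u1 t * cos (th t)) ^+ 2); last first.
    by ring: (cos2sin2 (th t)).
  by rewrite lerDl sqr_ge0.
Qed.

End Horizontal.

(** * The Gudermannian and the tractrix *)

Section Tractrix.
Context {R : realType}.
Notation mu := (@lebesgue_measure R).
Implicit Types (a b t : R).

(* The solution of [th' = cos th] with [th 0 = 0]. *)
Definition gudermann t : R := 2 * atan (expR t) - pi / 2.

Lemma gudermann0 : gudermann 0 = 0.
Proof. by rewrite /gudermann expR0 atan1; field. Qed.

(** The right-hand side is sech t. The shift by pi / 2 turns the cosine into the sine of twice
    [atan (expR t)], and the double-angle formula applies. *)
Lemma cos_gudermann t : cos (gudermann t) = 2 * expR t * (1 + expR t ^+ 2)^-1.
Proof.
rewrite /gudermann cosBpihalf mulrC mulr_natr sin_mulr2n.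
have c0 : 0 < cos (atan (expR t)).
  by apply: cos_gt0_pihalf; rewrite atan_gtNpi2 atan_ltpi2.
have sE : sin (atan (expR t)) = expR t * cos (atan (expR t)).
  have := atanK (expR t); rewrite /tan => e; rewrite -[X in _ = X * _]e divfK//.
  by rewrite gt_eqF.
have := cos2_tan2 (lt0r_neq0 c0); rewrite atanK => <-.
by rewrite sE invrK; ring.
Qed.

Lemma cos_gudermann_gt0 t : 0 < cos (gudermann t).
Proof.
have e0 := expR_gt0 t.
by rewrite cos_gudermann mulr_gt0 ?mulr_gt0// invr_gt0 addr_gt0// exprn_gt0.
Qed.

Lemma is_derive_gudermann t : is_derive t 1 gudermann (cos (gudermann t)).
Proof.
rewrite cos_gudermann /gudermann.
have d := is_derive1_comp (is_derive1_atan (expR t)) (is_derive_expR t).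
apply: (is_derive_eq (is_deriveB (is_deriveZ 2 d) (is_derive_cst (pi / 2 : R) t 1))).
by rewrite subr0 /GRing.scale/=; ring.
Qed.

Lemma continuous_gudermann : continuous gudermann.
Proof.
move=> t; apply: differentiable_continuous; apply/derivable1_diffP.
have d := is_derive_gudermann t; exact: ex_derive.
Qed.

Let th := gudermann.
(** The controls are the components of the horizontal gradient of [calibration]: X1 f = - sin and X2
    f = cos. *)
Let u1 t := - sin (th t).
Let u2 t := cos (th t).

(** Since cos th = sech t and sin th = tanh t, the plane part is (sech t - 1, tanh t - t), a
    tractrix with asymptote x = -1. *)
Definition tractrix t : SE2 R := se2 (cos (th t) - 1, sin (th t) - t, th t).

Lemma continuous_cos_gudermann : continuous u2.
Proof.
move=> t; apply: continuous_comp; first exact: continuous_gudermann.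
exact: continuous_cos.
Qed.

Lemma continuous_sin_gudermann : continuous (fun t => sin (th t)).
Proof.
move=> t; apply: continuous_comp; first exact: continuous_gudermann.
exact: continuous_sin.
Qed.

Lemma is_derive_cos_gudermann t :
  is_derive t 1 (fun t => cos (th t)) (u1 t * cos (th t)).
Proof.
have d := is_derive1_comp (is_derive_cos (th t)) (is_derive_gudermann t).
exact: d.
Qed.

Lemma is_derive_sin_gudermann t :
  is_derive t 1 (fun t => sin (th t)) (u2 t * cos (th t)).
Proof.
have d := is_derive1_comp (is_derive_sin (th t)) (is_derive_gudermann t).
exact: d.
Qed.

Lemma horizontal_tractrix a b : a <= b -> horizontal a b tractrix u1 u2.
Proof.
move=> ab; have cu1 : continuous u1.
  by move=> t; apply: cvgN; exact: continuous_sin_gudermann.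
have cu2 := continuous_cos_gudermann.
split.
- by apply: measurable_funTS; exact: continuous_measurable_fun.
- by apply: measurable_funTS; exact: continuous_measurable_fun.
- by exists 1 => t _; rewrite /u1 /u2 normrN sin_max cos_max.
- exists (fun t => cos (th t) - 1), (fun t => sin (th t) - t), th => t tab.
  split=> //.
  + apply: (@primitive_of_derivative _ a b (fun t => cos (th t) - 1)
      (fun s => u1 s * cos (th s)) ab) => // [s|].
      apply: (is_derive_eq (is_deriveB (is_derive_cos_gudermann s)
        (is_derive_cst (1 : R) s 1))).
      by rewrite subr0.
    by move=> s; apply: cvgM; [exact: cu1|exact: cu2].
  + apply: (@primitive_of_derivative _ a b (fun t => sin (th t) - t)
      (fun s => u1 s * sin (th s)) ab) => // [s|].
      apply: (is_derive_eq (is_deriveB (is_derive_sin_gudermann s)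
        (is_derive_id s 1))); rewrite /u1 /u2.
      by ring: (cos2sin2 (th s)).
    by move=> s; apply: cvgM; [exact: cu1|exact: continuous_sin_gudermann].
  + apply: (@primitive_of_derivative _ a b th u2 ab) => // s.
    exact: is_derive_gudermann.
Qed.

(** [minimizer] speaks of all controls of the curve, possibly with another lift [ph] of the angle;
    they are shown to agree almost everywhere with [u1] and [u2], which have unit speed. *)
Lemma length_tractrix a b (v1 v2 : R -> R) : a <= b -> horizontal a b tractrix v1 v2 ->
  length a b v1 v2 = b - a.
Proof.
rewrite le_eqVlt => /predU1P[<- _|ab]; first by rewrite /length Rintegral_itv1 subrr.
move=> hor; have [b1 b2] := horizontal_controls hor.
case: hor => _ _ _ [x [y [ph h]]].
have lab := ltW ab.
have aab : a \in `[a, b] by rewrite in_itv/= lexx.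
have trig t : t \in `[a, b] -> cos (ph t) = cos (th t) /\ sin (ph t) = sin (th t).
  by move=> /h[/se2_eqP[]].
have bc : bounded_measurable a b (fun t => cos (th t)).
  exact: bounded_measurable_continuous continuous_cos_gudermann.
have bs : bounded_measurable a b (fun t => sin (th t)).
  exact: bounded_measurable_continuous continuous_sin_gudermann.
have bu1 : bounded_measurable a b u1.
  rewrite (_ : u1 = fun t => -1 * sin (th t)); last by apply/funext => t; rewrite mulN1r.
  by apply: bounded_measurableM => //; exact: bounded_measurable_cst.
have phE t : t \in `[a, b] -> ph t = ph a + \int[mu]_(s in `[a, t]) v2 s.
  by move=> /h[].
have sub t : t \in `[a, b] -> `[a, t] `<=` `[a, b].
  by rewrite in_itv/= => /andP[_ tb]; apply: subset_itv; rewrite bnd_simp.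
have S f t : bounded_measurable a b f -> t \in `[a, b] -> bounded_measurable a t f.
  by rewrite in_itv/= => bf /andP[_ tb]; exact: bounded_measurableS bf.
(* The two lifts are compared through [sin], whose derivative carries the factor [cos]; this factor
   is positive along the curve and is cancelled at the end. *)
have ae2 : {ae mu, forall t, t \in `]a, b[ -> v2 t * cos (th t) - u2 t * cos (th t) = 0}.
  apply: ae_eq0_of_primitive => //.
    by apply: bounded_measurableB; exact: bounded_measurableM.
  move=> t tab; rewrite RintegralB_bm; [|by apply: S => //; exact: bounded_measurableM..].
  have := sin_primitive lab b2 phE tab.
  have [_ ->] := trig t tab; have [_ ->] := trig a aab.
  rewrite (primitive_of_derivative lab is_derive_sin_gudermann _ tab); last first.
    by move=> s; apply: cvgM; exact: continuous_cos_gudermann.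
  move=> /addrI ->; apply/eqP; rewrite subr_eq0; apply/eqP.
  by apply: eq_Rintegral => s; rewrite inE/= => /(sub t tab)/trig[->].
have ae1 : {ae mu, forall t, t \in `]a, b[ -> v1 t * cos (th t) - u1 t * cos (th t) = 0}.
  apply: ae_eq0_of_primitive => //.
    by apply: bounded_measurableB; exact: bounded_measurableM.
  move=> t tab; rewrite RintegralB_bm; [|by apply: S => //; exact: bounded_measurableM..].
  have [/se2_eqP[_ _ /= xt _]] := h t tab; have [/se2_eqP[_ _ /= xa _] _ _ _] := h a aab.
  rewrite -xt -xa => + _ _.
  rewrite (primitive_of_derivative lab is_derive_cos_gudermann _ tab); last first.
    move=> s; apply: cvgM; last exact: continuous_cos_gudermann.
    by apply: cvgN; exact: continuous_sin_gudermann.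
  move=> e; apply/eqP; rewrite subr_eq0; apply/eqP.
  rewrite [RHS](_ : _ = \int[mu]_(s in `[a, t]) (v1 s * cos (ph s))); last by lra.
  by apply: eq_Rintegral => s; rewrite inE/= => /(sub t tab)/trig[->].
rewrite /length (@eq_Rintegral_ae _ a b _ (fun=> 1)).
- by rewrite Rintegral_itv_cst// mul1r.
- exact: bounded_measurable_speed.
- exact: bounded_measurable_cst.
- apply: filterS2 ae1 ae2; first exact: (ae_filter_ringOfSetsType mu).
  move=> t h1 h2 tab; move: (h1 tab) (h2 tab).
  rewrite -!mulrBl => /eqP; rewrite mulf_eq0 (gt_eqF (cos_gudermann_gt0 t)) orbF subr_eq0 => /eqP e1.
  move=> /eqP; rewrite mulf_eq0 (gt_eqF (cos_gudermann_gt0 t)) orbF subr_eq0 => /eqP e2.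
  by rewrite /speed e1 e2 /u1 /u2 sqrrN addrC cos2Dsin2 sqrtr1.
Qed.

Lemma tractrix_geodesic : arclength_geodesic tractrix.
Proof.
split.
  exists u1, u2; split; first exact: horizontal_tractrix.
  apply: filterE; first exact: (ae_filter_ringOfSetsType mu).
  move=> t.
  by rewrite /speed /u1 /u2 sqrrN addrC cos2Dsin2 sqrtr1.
(* The calibration takes the value [t] at [tractrix t], so every arc is minimizing and any radius
   would do. *)
move=> t; exists 1 => // a b _ ab _; split.
  by exists u1, u2; exact: horizontal_tractrix.
move=> v1 v2 hor a' b' q' w1 w2 ab' hor' qa qb.
rewrite (length_tractrix ab hor); apply: le_trans (calibration_le_length ab' hor').
by rewrite qa qb !calibration_se2/=; lra.
Qed.

Lemma tractrix0 : tractrix 0 = se2 (0, 0, 0).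
Proof. by rewrite /tractrix /th gudermann0 cos0 sin0 !subr0 subrr. Qed.

(** The entry is the coordinate y, which vanishes on both curves of the theorem. At t = 2 it equals
    sin th - 2 < 0. *)
Lemma tractrix_leaves_axis : exists t, set_val (tractrix t) 1 2 != 0.
Proof.
exists 2; rewrite /tractrix se2E; have [_ _ _ ->] := rigid_mxE (cos (th 2) - 1, sin (th 2) - 2, th 2) => /=.
by have := sin_le1 (th 2); lra.
Qed.

End Tractrix.

(** * Symmetry of second derivatives *)

Section SecondDerivatives.
Context {R : realType} {V : normedModType R}.
Implicit Types (f : V -> R) (p q v w : V).

Lemma derive_lineE f q v (t : R) :
  (fun h : R => h^-1 *: (f ((h *: 1 + t) *: v + q) - f (t *: v + q))) =
  (fun h : R => h^-1 *: (f (h *: v + (t *: v + q)) - f (t *: v + q))).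
Proof. apply/funext => h; have -> : h *: (1 : R) = h by exact: mulr1.
by rewrite scalerDl addrA. Qed.

Lemma is_derive_line f q v (t : R) : derivable f (t *: v + q) v ->
  is_derive t 1 (fun t : R => f (t *: v + q)) ('D_v f (t *: v + q)).
Proof.
move=> df; apply: DeriveDef; first by rewrite /derivable/= derive_lineE.
by rewrite /derive/= derive_lineE.
Qed.

Lemma is_derive_of_line f q v d :
  is_derive (0 : R) 1 (fun t : R => f (t *: v + q)) d -> is_derive q v f d.
Proof.
move=> [df <-]; apply: DeriveDef.
  by move: df; rewrite /derivable/= derive_lineE scale0r add0r.
by rewrite /derive/= derive_lineE scale0r add0r.
Qed.

(** The mean value theorem in the direction [v] turns the second difference into a difference of two
    values of ['D_v f], each expanded to first order at [p]. The second difference is symmetric in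
    [v] and [w]. *)
Lemma second_difference f p v w : (forall x, differentiable f x) ->
  differentiable ('D_v f) p -> forall e : R, 0 < e ->
  exists2 d : R, 0 < d & forall h : R, 0 < h -> h < d ->
    `|f (h *: v + (h *: w + p)) - f (h *: v + p) - f (h *: w + p) + f p
      - h ^+ 2 * 'D_w ('D_v f) p| <= e * h ^+ 2.
Proof.
move=> df dG e e0; set G := 'D_v f.
(* The two expansions are taken at [c *: v + h *: w] and [c *: v], whose norms add up to at most
   [h * (2 * |v| + |w|)]; the summand 1 keeps [N] positive. *)
pose N := 2 * `|v| + `|w| + 1.
have N0 : 0 < N by rewrite /N; have := normr_ge0 v; have := normr_ge0 w; lra.
have [d d0 hd] : exists2 d : R, 0 < d & forall k : V, `|k| < d ->
    `|G (k + p) - G p - 'd G p k| <= e / N * `|k|.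
  have /eqaddoP/(_ (e / N)) := diff_locally dG.
  rewrite divr_gt0// => /(_ isT) /nbhs_norm0P [d /= d0 hd]; exists d => // k kd.
  by rewrite -addrA -opprD; exact: hd.
exists (d / N); first exact: divr_gt0.
move=> h h0 hdN.
pose g t := f (t *: v + (h *: w + p)) - f (t *: v + p).
have dg (t : R) : is_derive t 1 g (G (t *: v + (h *: w + p)) - G (t *: v + p)).
  by apply: is_deriveB; apply: is_derive_line; exact: diff_derivable.
have [|c /[!in_itv]/= /andP[c0 ch]] := MVT h0 (fun t _ => dg t).
  apply: continuous_subspaceT => t; apply: differentiable_continuous.
  by apply/derivable1_diffP; have := dg t; move=> /@ex_derive.
rewrite subr0 /g !scale0r !add0r => gE.
have hN : h * N < d by rewrite -ltr_pdivlMr.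
have nv := normr_ge0 v; have nw := normr_ge0 w.
have k1 : `|c *: v + h *: w| <= h * (`|v| + `|w|).
  rewrite (le_trans (ler_normD _ _))// !normrZ !gtr0_norm// mulrDr lerD2r ler_wpM2r//.
  exact: ltW.
have k2 : `|c *: v| <= h * `|v|.
  by rewrite normrZ gtr0_norm// ler_wpM2r// ltW.
have hv : 0 <= h * `|v| by rewrite mulr_ge0// ltW.
have hw : 0 <= h * `|w| by rewrite mulr_ge0// ltW.
have hNE : h * N = 2 * (h * `|v|) + h * `|w| + h by rewrite /N; ring.
have H1 : `|G (c *: v + (h *: w + p)) - G p - 'd G p (c *: v + h *: w)| <=
    e / N * `|c *: v + h *: w|.
  rewrite addrA; apply: hd; apply: le_lt_trans k1 _; rewrite mulrDr; lra.
have H2 : `|G (c *: v + p) - G p - 'd G p (c *: v)| <= e / N * `|c *: v|.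
  by apply: hd; apply: le_lt_trans k2 _; lra.
have -> : 'D_w G p = 'd G p w by rewrite deriveE.
have dE : 'd G p (c *: v + h *: w) = 'd G p (c *: v) + h * 'd G p w.
  by rewrite linearD; congr (_ + _); exact: linearZ.
move: gE H1 H2; rewrite dE; set A := G (c *: v + _); set B := G (c *: v + p).
set L := 'd G p (c *: v); set M := 'd G p w.
set F1 := f _; set F2 := f _; set F3 := f _; set F4 := f _.
move=> gE H1 H2.
have -> : F1 - F2 - F3 + F4 - h ^+ 2 * M =
    h * ((A - G p - (L + h * M)) - (B - G p - L)).
  by rewrite (_ : F1 - F2 - F3 + F4 = (A - B) * h); [ring|rewrite -gE; ring].
rewrite normrM gtr0_norm// (_ : e * h ^+ 2 = h * (e * h)); last by ring.
rewrite ler_pM2l// (le_trans (ler_normB _ _))// (le_trans (lerD H1 H2))//.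
rewrite -mulrDr (_ : e * h = e / N * (h * N)); last by field; rewrite gt_eqF.
rewrite ler_pM2l ?divr_gt0//.
by apply: le_trans (lerD k1 k2) _; rewrite mulrDr; lra.
Qed.

(* Schwarz's theorem in the form that only requires the first directional
   derivatives to be differentiable at the point. *)
Lemma derive_commute f p v w : (forall x, differentiable f x) ->
  differentiable ('D_v f) p -> differentiable ('D_w f) p ->
  'D_w ('D_v f) p = 'D_v ('D_w f) p.
Proof.
move=> df dv dw; apply/eqP; rewrite -subr_eq0 -normr_le0.
apply/ler_addgt0Pr => e e0; rewrite add0r.
have e20 : 0 < e / 2 by lra.
have [d1 d10 h1] := second_difference w df dv e20.
have [d2 d20 h2] := second_difference v df dw e20.
pose h := Num.min d1 d2 / 2.
have m0 : 0 < Num.min d1 d2 by rewrite lt_min d10 d20.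
have h0 : 0 < h by rewrite /h; lra.
have hd1 : h < d1.
  by apply: lt_le_trans (_ : Num.min d1 d2 <= _); [rewrite /h; lra|rewrite ge_min lexx].
have hd2 : h < d2.
  by apply: lt_le_trans (_ : Num.min d1 d2 <= _); [rewrite /h; lra|rewrite ge_min lexx orbT].
have {}h1 := h1 h h0 hd1; have {}h2 := h2 h h0 hd2.
have sq0 : 0 < h ^+ 2 by rewrite exprn_gt0.
rewrite -(ler_pM2l sq0) -{1}(gtr0_norm sq0) -normrM.
have -> : h ^+ 2 * e = e / 2 * h ^+ 2 + e / 2 * h ^+ 2 by field.
apply: le_trans (lerD h2 h1).
apply: le_trans (ler_normB _ _).
rewrite (_ : h *: w + (h *: v + p) = h *: v + (h *: w + p)); last by rewrite addrCA.
move: (f (h *: v + (h *: w + p))) (f (h *: v + p)) (f (h *: w + p)) (f p).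
move: ('D_w ('D_v f) p) ('D_v ('D_w f) p) => A B F1 F2 F3 F4.
rewrite (_ : _ * (A - B) = (F1 - F3 - F2 + F4 - h ^+ 2 * B) -
  (F1 - F2 - F3 + F4 - h ^+ 2 * A)); last by ring.
by [].
Qed.

End SecondDerivatives.

(** * The left-invariant frame *)

Section TrigAffine.
Context {R : realType}.
Implicit Types (p v w : R * R * R).

Lemma differentiable_fst (p : R * R * R) :
  differentiable (fun q : R * R * R => q.1) p.
Proof. by apply: (@linear_differentiable _ _ _ fst); move=> x; exact: cvg_fst. Qed.

Lemma differentiable_x (p : R * R * R) :
  differentiable (fun q : R * R * R => q.1.1) p.
Proof.
apply: (@differentiable_comp _ _ _ _ fst fst); first exact: differentiable_fst.
by apply: linear_differentiable; move=> x; exact: cvg_fst.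
Qed.

Lemma differentiable_y (p : R * R * R) :
  differentiable (fun q : R * R * R => q.1.2) p.
Proof.
apply: (@differentiable_comp _ _ _ _ fst snd); first exact: differentiable_fst.
by apply: linear_differentiable; move=> x; exact: cvg_snd.
Qed.

Lemma differentiable_angle (p : R * R * R) :
  differentiable (fun q : R * R * R => q.2) p.
Proof. by apply: (@linear_differentiable _ _ _ snd); move=> x; exact: cvg_snd. Qed.

Lemma differentiable_cos_angle (p : R * R * R) :
  differentiable (fun q : R * R * R => cos q.2) p.
Proof.
apply: (@differentiable_comp _ _ _ _ snd cos); first exact: differentiable_angle.
by apply/derivable1_diffP; exact: derivable_cos.
Qed.

Lemma differentiable_sin_angle (p : R * R * R) :
  differentiable (fun q : R * R * R => sin q.2) p.
Proof.
apply: (@differentiable_comp _ _ _ _ snd sin); first exact: differentiable_angle.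
by apply/derivable1_diffP; exact: derivable_sin.
Qed.

Lemma is_derive_affine (c d t : R) : is_derive t 1 (fun t => t * c + d) c.
Proof.
have h : is_derive t 1 (fun t => t * c) c.
  rewrite (_ : (fun t => t * c) = c \*: id); last by apply/funext => x /=; rewrite mulrC.
  by apply: (is_derive_eq (is_deriveZ c (is_derive_id t 1))); rewrite /GRing.scale/= mulr1.
by apply: (is_derive_eq (is_deriveD h (is_derive_cst d t 1))); rewrite addr0.
Qed.

Lemma is_derive_cos_angle p v :
  is_derive p v (fun q : R * R * R => cos q.2) (- sin p.2 * v.2).
Proof.
apply: is_derive_of_line.
have h := @is_derive1_comp _ cos (fun t => t * v.2 + p.2) 0 _ _ (is_derive_cos (0 * v.2 + p.2)) (is_derive_affine v.2 p.2 0).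
by apply: (is_derive_eq h); rewrite mul0r add0r.
Qed.

Lemma is_derive_sin_angle p v :
  is_derive p v (fun q : R * R * R => sin q.2) (cos p.2 * v.2).
Proof.
apply: is_derive_of_line.
have h := @is_derive1_comp _ sin (fun t => t * v.2 + p.2) 0 _ _ (is_derive_sin (0 * v.2 + p.2)) (is_derive_affine v.2 p.2 0).
by apply: (is_derive_eq h); rewrite mul0r add0r.
Qed.

Lemma is_derive_x p v : is_derive p v (fun q : R * R * R => q.1.1) v.1.1.
Proof. by apply: is_derive_of_line; exact: (is_derive_affine v.1.1 p.1.1 0). Qed.

Lemma is_derive_y p v : is_derive p v (fun q : R * R * R => q.1.2) v.1.2.
Proof. by apply: is_derive_of_line; exact: (is_derive_affine v.1.2 p.1.2 0). Qed.

(** The span of 1, cos, sin, x, y is closed under directional derivatives and contains [rigid_mx]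
    and its left translates. Their smoothness thus follows by an induction over all coefficients. *)
Definition trig_affine {W : lmodType R} (A0 A1 A2 A3 A4 : W) (p : R * R * R) : W :=
  A0 + cos p.2 *: A1 + sin p.2 *: A2 + p.1.1 *: A3 + p.1.2 *: A4.

Lemma is_derive_trig_affine (a0 a1 a2 a3 a4 : R) p v :
  is_derive p v (trig_affine (W := R^o) a0 a1 a2 a3 a4)
    (- sin p.2 * v.2 * a1 + cos p.2 * v.2 * a2 + v.1.1 * a3 + v.1.2 * a4).
Proof.
have M (f : R * R * R -> R) (a d : R) : is_derive p v f d ->
    is_derive p v (fun q => f q * a) (d * a).
  move=> h; rewrite (_ : (fun q => _) = a \*: f); last first.
    by apply/funext => q; rewrite /= mulrC.
  by apply: (is_derive_eq (is_deriveZ a h)); rewrite mulrC.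
have h1 := M _ a1 _ (is_derive_cos_angle p v).
have h2 := M _ a2 _ (is_derive_sin_angle p v).
have h3 := M _ a3 _ (is_derive_x p v).
have h4 := M _ a4 _ (is_derive_y p v).
have h := is_deriveD (is_deriveD (is_deriveD (is_deriveD
  (is_derive_cst a0 p v) h1) h2) h3) h4.
by apply: (is_derive_eq h); rewrite add0r.
Qed.

Lemma differentiable_trig_affine m n (A0 A1 A2 A3 A4 : 'M[R]_(m.+1, n.+1)) p :
  differentiable (trig_affine A0 A1 A2 A3 A4) p.
Proof.
have h0 : differentiable (cst A0) p by exact: differentiable_cst.
have h1 := differentiableZl A1 (differentiable_cos_angle p).
have h2 := differentiableZl A2 (differentiable_sin_angle p).
have h3 := differentiableZl A3 (differentiable_x p).
have h4 := differentiableZl A4 (differentiable_y p).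
exact: (differentiableD (differentiableD (differentiableD (differentiableD h0 h1) h2) h3) h4).
Qed.

Lemma trig_affineE m n (A0 A1 A2 A3 A4 : 'M[R]_(m, n)) p i j :
  trig_affine A0 A1 A2 A3 A4 p i j =
  trig_affine (W := R^o) (A0 i j) (A1 i j) (A2 i j) (A3 i j) (A4 i j) p.
Proof. by rewrite /trig_affine !mxE. Qed.

Lemma derive_entry m n (F : R * R * R -> 'M[R]_(m.+1, n.+1)) p v i j :
  differentiable F p -> 'D_v F p i j = 'D_v (fun q => F q i j) p.
Proof. by move=> dF; rewrite derive_mx ?mxE//; exact: diff_derivable. Qed.

Lemma derive_trig_affine m n (A0 A1 A2 A3 A4 : 'M[R]_(m.+1, n.+1)) v :
  'D_v (trig_affine A0 A1 A2 A3 A4) =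
  trig_affine (v.1.1 *: A3 + v.1.2 *: A4) (v.2 *: A2) (- v.2 *: A1) 0 0.
Proof.
apply/funext => p; apply/matrixP => i j.
rewrite derive_entry; last exact: differentiable_trig_affine.
rewrite (_ : (fun q => _) = trig_affine (W := R^o) (A0 i j) (A1 i j) (A2 i j) (A3 i j) (A4 i j)).
  have h := is_derive_trig_affine (A0 i j) (A1 i j) (A2 i j) (A3 i j) (A4 i j) p v.
  rewrite derive_val trig_affineE /trig_affine !mxE /GRing.scale/=; ring.
by apply/funext => q; rewrite trig_affineE.
Qed.

Lemma Cinfty_trig_affine m n (A0 A1 A2 A3 A4 : 'M[R]_(m.+1, n.+1)) :
  Cinfty (trig_affine A0 A1 A2 A3 A4).
Proof.
move=> k; elim: k A0 A1 A2 A3 A4 => [|k IH] A0 A1 A2 A3 A4 /=.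
  by move=> p; apply: differentiable_continuous; exact: differentiable_trig_affine.
split; first by move=> p; exact: differentiable_trig_affine.
by move=> v; rewrite derive_trig_affine; exact: IH.
Qed.

Definition rot_cos : 'M[R]_3 := delta_mx 0 0 + delta_mx 1 1.
Definition rot_sin : 'M[R]_3 := delta_mx 1 0 - delta_mx 0 1.

Lemma rigid_mx_trig_affine : rigid_mx =
  trig_affine (delta_mx 2 2) rot_cos rot_sin (delta_mx 0 2) (delta_mx 1 2).
Proof.
apply/funext => -[[x y] th]; apply/matrixP => i j.
rewrite trig_affineE /trig_affine /= !mxE /GRing.scale/=.
by case: i => -[|[|[|//]]] i; case: j => -[|[|[|//]]] j; rewrite /= ?mxE/=; ring.
Qed.

Lemma derive_rigid_mx p v : 'D_v rigid_mx p =
  \matrix_(i < 3, j < 3)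
    nth 0 (nth [::] [:: [:: - sin p.2 * v.2; - cos p.2 * v.2; v.1.1];
                        [:: cos p.2 * v.2; - sin p.2 * v.2; v.1.2];
                        [::      0;        0; 0]] i) j.
Proof.
have E := congr1 (fun F => F p) (@derive_trig_affine 2 2 (delta_mx 2 2) rot_cos
  rot_sin (delta_mx 0 2) (delta_mx 1 2) v).
rewrite rigid_mx_trig_affine; apply: (etrans E); apply/matrixP => i j.
rewrite trig_affineE /trig_affine /= !mxE /GRing.scale/=.
by case: i => -[|[|[|//]]] i; case: j => -[|[|[|//]]] j; rewrite /= ?mxE/=; ring.
Qed.

Lemma tangentE p v : tangent p v = 'D_v rigid_mx p.
Proof. by []. Qed.

End TrigAffine.

(** * Derivations and the brackets of the frame *)

Section Derivations.
Context {R : realType}.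
Local Notation V := (R * R * R)%type.
Implicit Types (p v : V) (f g : V -> R) (D : (V -> R) -> V -> R).

Definition diffable f := forall p, differentiable f p.
Definition twice_diffable f := diffable f /\ forall v, diffable ('D_v f).

Lemma diffableD f g : diffable f -> diffable g -> diffable (fun p => f p + g p).
Proof. by move=> df dg p; exact: differentiableD. Qed.

Lemma diffableB f g : diffable f -> diffable g -> diffable (fun p => f p - g p).
Proof. by move=> df dg p; exact: differentiableB. Qed.

Lemma diffableN f : diffable f -> diffable (fun p => - f p).
Proof. by move=> df p; exact: differentiableN. Qed.

Lemma diffableM f g : diffable f -> diffable g -> diffable (fun p => f p * g p).
Proof. by move=> df dg p; exact: differentiableM. Qed.

Lemma diffable_cst (c : R) : diffable (fun=> c).
Proof. by move=> p; exact: differentiable_cst. Qed.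

Lemma diffable_cos : diffable (fun p => cos p.2).
Proof. exact: differentiable_cos_angle. Qed.

Lemma diffable_sin : diffable (fun p => sin p.2).
Proof. exact: differentiable_sin_angle. Qed.

(** Isolates the product rule so that the computations with vector fields become pure algebra;
    differentiability is part of each clause because directional derivatives are total functions. *)
Definition derivation D := [/\
  forall f g, diffable f -> diffable g -> forall p,
    D (fun q => f q + g q) p = D f p + D g p,
  forall f g, diffable f -> diffable g -> forall p,
    D (fun q => f q * g q) p = D f p * g p + f p * D g p &
  forall c p, D (fun=> c) p = 0].

Lemma derivation_derive v : derivation (fun f => 'D_v f).
Proof.
split=> [f g df dg p|f g df dg p|c p].
- by apply: deriveD; apply: diff_derivable.
- rewrite (@deriveM _ _ f g); [|exact: diff_derivable..].
  by rewrite addrC /GRing.scale/= mulrC.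
- exact: derive_cst.
Qed.

Lemma derivation_comb D D' (a b : V -> R) : derivation D -> derivation D' ->
  derivation (fun f p => a p * D f p + b p * D' f p).
Proof.
move=> [DD DM Dc] [DD' DM' Dc']; split=> [f g df dg p|f g df dg p|c p].
- by rewrite DD// DD'//; ring.
- by rewrite DM// DM'//; ring.
- by rewrite Dc Dc' !mulr0 addr0.
Qed.

Lemma derivationN D f p : derivation D -> diffable f ->
  D (fun q => - f q) p = - D f p.
Proof.
move=> [_ DM Dc] df; rewrite (_ : (fun q => - f q) = fun q => (fun=> -1) q * f q).
  by rewrite DM// ?Dc ?mul0r ?add0r ?mulN1r//; exact: diffable_cst.
by apply/funext => q; rewrite mulN1r.
Qed.

Lemma derivationB D f g p : derivation D -> diffable f -> diffable g ->
  D (fun q => f q - g q) p = D f p - D g p.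
Proof.
move=> dD df dg; have [DD _ _] := dD.
by rewrite (DD f (fun q => - g q))// ?derivationN//; exact: diffableN.
Qed.

Lemma derivation_lincomb D (a f b g : V -> R) p : derivation D -> diffable a ->
  diffable f -> diffable b -> diffable g ->
  D (fun q => a q * f q + b q * g q) p =
  D a p * f p + a p * D f p + (D b p * g p + b p * D g p).
Proof.
move=> [DD DM _] da df db dg; rewrite (DD (fun q => a q * f q) (fun q => b q * g q)).
- by rewrite !DM.
- exact: diffableM.
- exact: diffableM.
Qed.

Definition DX f p := 'D_((1, 0, 0) : V) f p.
Definition DY f p := 'D_((0, 1, 0) : V) f p.
(* The left-invariant frame [X1], [X2], [X3 = [X1, X2]] acting on functions. *)
Definition D1 f p := cos p.2 * DX f p + sin p.2 * DY f p.
Definition D2 f p := 'D_((0, 0, 1) : V) f p.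
Definition D3 f p := sin p.2 * DX f p + - cos p.2 * DY f p.

Lemma derivation_D1 : derivation D1.
Proof. by apply: derivation_comb; exact: derivation_derive. Qed.

Lemma derivation_D2 : derivation D2. Proof. exact: derivation_derive. Qed.

Lemma derivation_D3 : derivation D3.
Proof. by apply: derivation_comb; exact: derivation_derive. Qed.

Lemma diffable_D1 f : twice_diffable f -> diffable (D1 f).
Proof.
move=> [_ d2f]; apply: diffableD; apply: diffableM.
- exact: diffable_cos.
- exact: d2f.
- exact: diffable_sin.
- exact: d2f.
Qed.

Lemma diffable_D2 f : twice_diffable f -> diffable (D2 f).
Proof. by move=> [_ d2f]; exact: d2f. Qed.

Lemma diffable_D3 f : twice_diffable f -> diffable (D3 f).
Proof.
move=> [_ d2f]; apply: diffableD; apply: diffableM.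
- exact: diffable_sin.
- exact: d2f.
- by apply: diffableN; exact: diffable_cos.
- exact: d2f.
Qed.

Lemma D1_cos p : D1 (fun q => cos q.2) p = 0.
Proof.
rewrite /D1 /DX /DY.
have h1 := is_derive_cos_angle p (1, 0, 0); rewrite derive_val.
have h2 := is_derive_cos_angle p (0, 1, 0); rewrite derive_val.
by rewrite /=; ring.
Qed.

Lemma D1_sin p : D1 (fun q => sin q.2) p = 0.
Proof.
rewrite /D1 /DX /DY.
have h1 := is_derive_sin_angle p (1, 0, 0); rewrite derive_val.
have h2 := is_derive_sin_angle p (0, 1, 0); rewrite derive_val.
by rewrite /=; ring.
Qed.

Lemma D3_cos p : D3 (fun q => cos q.2) p = 0.
Proof.
rewrite /D3 /DX /DY.
have h1 := is_derive_cos_angle p (1, 0, 0); rewrite derive_val.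
have h2 := is_derive_cos_angle p (0, 1, 0); rewrite derive_val.
by rewrite /=; ring.
Qed.

Lemma D3_sin p : D3 (fun q => sin q.2) p = 0.
Proof.
rewrite /D3 /DX /DY.
have h1 := is_derive_sin_angle p (1, 0, 0); rewrite derive_val.
have h2 := is_derive_sin_angle p (0, 1, 0); rewrite derive_val.
by rewrite /=; ring.
Qed.

Lemma D2_cos p : D2 (fun q => cos q.2) p = - sin p.2.
Proof.
rewrite /D2; have h1 := is_derive_cos_angle p (0, 0, 1).
by rewrite derive_val mulr1.
Qed.

Lemma D2_sin p : D2 (fun q => sin q.2) p = cos p.2.
Proof.
rewrite /D2; have h1 := is_derive_sin_angle p (0, 0, 1).
by rewrite derive_val mulr1.
Qed.

Lemma D1_x p : D1 (fun q => q.1.1) p = cos p.2.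
Proof.
rewrite /D1 /DX /DY; have h1 := is_derive_x p (1, 0, 0); rewrite derive_val.
by have h2 := is_derive_x p (0, 1, 0); rewrite derive_val/=; ring.
Qed.

Lemma D1_y p : D1 (fun q => q.1.2) p = sin p.2.
Proof.
rewrite /D1 /DX /DY; have h1 := is_derive_y p (1, 0, 0); rewrite derive_val.
by have h2 := is_derive_y p (0, 1, 0); rewrite derive_val/=; ring.
Qed.

Lemma D3_x p : D3 (fun q => q.1.1) p = sin p.2.
Proof.
rewrite /D3 /DX /DY; have h1 := is_derive_x p (1, 0, 0); rewrite derive_val.
by have h2 := is_derive_x p (0, 1, 0); rewrite derive_val/=; ring.
Qed.

Lemma D3_y p : D3 (fun q => q.1.2) p = - cos p.2.
Proof.
rewrite /D3 /DX /DY; have h1 := is_derive_y p (1, 0, 0); rewrite derive_val.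
by have h2 := is_derive_y p (0, 1, 0); rewrite derive_val/=; ring.
Qed.

Lemma D2_x p : D2 (fun q => q.1.1) p = 0.
Proof. by rewrite /D2; have h1 := is_derive_x p (0, 0, 1); rewrite derive_val. Qed.

Lemma D2_y p : D2 (fun q => q.1.2) p = 0.
Proof. by rewrite /D2; have h1 := is_derive_y p (0, 0, 1); rewrite derive_val. Qed.

Lemma derive_commute_twice f p v w : twice_diffable f ->
  'D_w ('D_v f) p = 'D_v ('D_w f) p.
Proof. by move=> [df d2f]; apply: derive_commute => //; exact: d2f. Qed.

Lemma DX_DY f p : twice_diffable f -> DX (DY f) p = DY (DX f) p.
Proof. exact: derive_commute_twice. Qed.

Lemma D2_DX f p : twice_diffable f -> D2 (DX f) p = DX (D2 f) p.
Proof. exact: derive_commute_twice. Qed.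

Lemma D2_DY f p : twice_diffable f -> D2 (DY f) p = DY (D2 f) p.
Proof. exact: derive_commute_twice. Qed.

Lemma diffable_DX f : twice_diffable f -> diffable (DX f).
Proof. by case=> _; exact. Qed.

Lemma diffable_DY f : twice_diffable f -> diffable (DY f).
Proof. by case=> _; exact. Qed.

(** [A], [B], [T] stand for the three partial derivatives and [c], [s] for cos and sin. Everything
    follows from their commuting on [f] and from [T] rotating the pair [c], [s], which [A] and [B]
    annihilate. *)
Lemma bracket_algebra (A B T : (V -> R) -> V -> R) (c s f : V -> R) p :
  derivation A -> derivation B -> derivation T ->
  diffable c -> diffable s -> diffable (A f) -> diffable (B f) ->
  (forall q, [/\ A c q = 0, A s q = 0, B c q = 0 & B s q = 0]) ->
  (forall q, T c q = - s q) -> (forall q, T s q = c q) ->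
  A (B f) p = B (A f) p -> T (A f) p = A (T f) p -> T (B f) p = B (T f) p ->
  let E1 g q := c q * A g q + s q * B g q in
  let E3 g q := s q * A g q + - c q * B g q in
  [/\ E1 (T f) p = T (E1 f) p + E3 f p, T (E3 f) p = E3 (T f) p + E1 f p &
      E1 (E3 f) p = E3 (E1 f) p].
Proof.
move=> dA dB dT dc ds dAf dBf h Tc Ts AB TA TB E1 E3.
have [Ac As Bc Bs] := h p.
have dnc := diffableN dc.
have dE1 : derivation E1 by exact: derivation_comb.
have dE3 : derivation E3 by exact: derivation_comb.
have n1 : E1 (fun q => - c q) p = 0.
  by rewrite (derivationN p dE1 dc) /E1 Ac Bc; ring.
have e1c : E1 s p = 0 by rewrite /E1 As Bs; ring.
have e3c : E3 c p = 0 by rewrite /E3 Ac Bc; ring.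
have e3s : E3 s p = 0 by rewrite /E3 As Bs; ring.
have t1 := derivation_lincomb p dT dc dAf ds dBf.
have t3 := derivation_lincomb p dT ds dAf dnc dBf.
have u1 := derivation_lincomb p dE1 ds dAf dnc dBf.
have u3 := derivation_lincomb p dE3 dc dAf ds dBf.
rewrite Tc Ts TA TB in t1; rewrite (derivationN p dT dc) Tc Ts TA TB in t3.
rewrite n1 e1c in u1; rewrite e3c e3s in u3.
split.
- by rewrite /E1 t1 /E3; ring.
- by rewrite /E3 t3 /E1; ring.
- rewrite [LHS]u1 [RHS]u3 /E1 /E3 AB; ring.
Qed.

Lemma frame_brackets f p : twice_diffable f ->
  [/\ D1 (D2 f) p = D2 (D1 f) p + D3 f p, D2 (D3 f) p = D3 (D2 f) p + D1 f p &
      D1 (D3 f) p = D3 (D1 f) p].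
Proof.
move=> tf.
have h q : [/\ DX (fun r => cos r.2) q = 0, DX (fun r => sin r.2) q = 0,
    DY (fun r => cos r.2) q = 0 & DY (fun r => sin r.2) q = 0].
  have h1 := is_derive_cos_angle q (1, 0, 0); have h2 := is_derive_cos_angle q (0, 1, 0).
  have h3 := is_derive_sin_angle q (1, 0, 0); have h4 := is_derive_sin_angle q (0, 1, 0).
  split.
  - by rewrite /DX derive_val mulr0.
  - by rewrite /DX derive_val mulr0.
  - by rewrite /DY derive_val mulr0.
  - by rewrite /DY derive_val mulr0.
exact: (bracket_algebra (derivation_derive _) (derivation_derive _) derivation_D2
  diffable_cos diffable_sin (diffable_DX tf) (diffable_DY tf) h D2_cos D2_sin
  (DX_DY p tf) (D2_DX p tf) (D2_DY p tf)).
Qed.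

Lemma derive_frame f p v : diffable f -> 'D_v f p =
  v.1.1 * (cos p.2 * D1 f p + sin p.2 * D3 f p) +
  v.1.2 * (sin p.2 * D1 f p - cos p.2 * D3 f p) + v.2 * D2 f p.
Proof.
move=> df; have -> : 'D_v f p = v.1.1 * DX f p + v.1.2 * DY f p + v.2 * D2 f p.
  rewrite /DX /DY /D2 !deriveE//.
  have {1}-> : v = v.1.1 *: ((1, 0, 0) : V) + v.1.2 *: ((0, 1, 0) : V) + v.2 *: ((0, 0, 1) : V).
    case: v => -[a b] c; transitivity
      ((a * 1 + b * 0 + c * 0, a * 0 + b * 1 + c * 0, a * 0 + b * 0 + c * 1) : V) => //.
    by rewrite !mulr1 !mulr0 !addr0 !add0r.
  by rewrite 2!linearD; congr (_ + _ + _); exact: linearZ.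
rewrite /D1 /D3.
rewrite (_ : cos p.2 * _ + _ = DX f p); last by ring: (cos2sin2 p.2).
rewrite (_ : sin p.2 * _ - _ = DY f p) //; by ring: (cos2sin2 p.2).
Qed.

(** The frame spans the tangent space, so the derivative along the line through the origin and [p]
    vanishes. *)
Lemma constant_of_frame f : diffable f -> (forall p, D1 f p = 0) ->
  (forall p, D2 f p = 0) -> (forall p, D3 f p = 0) -> forall p, f p = f (0, 0, 0).
Proof.
move=> df h1 h2 h3 p.
have dl (t : R) : is_derive t 1 (fun t : R => f (t *: p + 0)) 0.
  apply: (is_derive_eq (is_derive_line _)); first exact: diff_derivable.
  by rewrite derive_frame// h1 h2 h3; ring.
have := @is_derive_0_is_cst _ (fun t : R => f (t *: p + 0)) 1 0 dl.
by rewrite scale1r scale0r !addr0.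
Qed.

Lemma derive_hvec f p u : diffable f ->
  'D_(hvec p u) f p = u.1 * D1 f p + u.2 * D2 f p.
Proof.
move=> df; rewrite derive_frame// /hvec /X1 /X2/= /GRing.scale/=.
by ring: (cos2sin2 p.2).
Qed.

End Derivations.

(** * Rigidity of isometries *)

Section Rigidity.
Context {R : realType}.
Local Notation V := (R * R * R)%type.
Implicit Types (p v : V) (f g : V -> R).

(** An orthogonal matrix is injective. It splits a pair of equations for the coordinates X, Y into
    the components along X1 and X3. *)
Lemma rotation_coords0 (c s A B : R) : c ^+ 2 + s ^+ 2 = 1 ->
  A * c + B * s = 0 -> A * s - B * c = 0 -> A = 0 /\ B = 0.
Proof.
move=> cs e1 e2; split.
  have : A = c * (A * c + B * s) + s * (A * s - B * c).
    by rewrite -[LHS]mulr1 -cs; ring.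
  by rewrite e1 e2 !mulr0 addr0.
have : B = s * (A * c + B * s) - c * (A * s - B * c).
  by rewrite -[LHS]mulr1 -cs; ring.
by rewrite e1 e2 !mulr0 subr0.
Qed.

Lemma derivation_unit (D : (V -> R) -> V -> R) (l : V -> R) p : derivation D ->
  diffable l -> (forall q, l q * l q = 1) -> D l p = 0.
Proof.
move=> [_ DM Dc] dl l1; have := DM l l dl dl p.
rewrite (_ : (fun q => l q * l q) = fun=> 1); last exact/funext.
rewrite Dc => e; have : l p * D l p = 0 by lra.
move=> h; rewrite -[D l p]mul1r -(l1 p) -mulrA h mulr0.
by [].
Qed.

(* [C = cos], [S = sin], [X], [Y] are the coordinates of an isometry and
   [m] is the matrix of its differential in the frames [X1], [X2].  The
   structure equations [X1, X2] = X3, [X2, X3] = X1, [X1, X3] = 0 pulled back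
   by the isometry force [m] to be diagonal with entries of square 1. *)
Lemma frame_rigidity (D1 D2 D3 : (V -> R) -> V -> R) (C S X Y : V -> R) :
  derivation D1 -> derivation D2 -> derivation D3 ->
  (forall f, f = C \/ f = S \/ f = X \/ f = Y ->
    [/\ diffable f, diffable (D1 f), diffable (D2 f), diffable (D3 f) &
    forall p, [/\ D1 (D2 f) p = D2 (D1 f) p + D3 f p,
      D2 (D3 f) p = D3 (D2 f) p + D1 f p & D1 (D3 f) p = D3 (D1 f) p]]) ->
  (forall p, C p ^+ 2 + S p ^+ 2 = 1) ->
  (forall p, exists a b a' b',
    [/\ [/\ D1 X p = a * C p, D1 Y p = a * S p, D1 C p = - (b * S p) & D1 S p = b * C p],
        [/\ D2 X p = a' * C p, D2 Y p = a' * S p, D2 C p = - (b' * S p) & D2 S p = b' * C p] &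
        [/\ a ^+ 2 + b ^+ 2 = 1, a' ^+ 2 + b' ^+ 2 = 1 & a * a' + b * b' = 0]]) ->
  let m1 p := C p * D1 X p + S p * D1 Y p in
  let m2 p := C p * D2 S p - S p * D2 C p in
  [/\ diffable m1, diffable m2, (forall p, m1 p * m1 p = 1),
      (forall p, m2 p * m2 p = 1) & forall p,
      [/\ D1 X p = m1 p * C p, D1 Y p = m1 p * S p, D1 C p = 0 & D1 S p = 0] /\
      [/\ D2 X p = 0, D2 Y p = 0, D2 C p = - (m2 p * S p) & D2 S p = m2 p * C p] /\
      [/\ D3 X p = m1 p * m2 p * S p, D3 Y p = - (m1 p * m2 p * C p),
          D3 C p = 0 & D3 S p = 0]].
Proof.
move=> d1 d2 d3 reg CS frame m11 m22.
have [dC dC1 dC2 dC3 brC] : _ := reg C (or_introl erefl).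
have [dS dS1 dS2 dS3 brS] : _ := reg S (or_intror (or_introl erefl)).
have [dX dX1 dX2 dX3 brX] : _ := reg X (or_intror (or_intror (or_introl erefl))).
have [dY dY1 dY2 dY3 brY] : _ := reg Y (or_intror (or_intror (or_intror erefl))).
(* The image of X1 has components [m11], [m21] along X1, X2, and that of X2 has [m12], [m22]; the
   image of X3 has [n1], [n2], [l] along X1, X2, X3. *)
pose m12 p := C p * D2 X p + S p * D2 Y p.
pose m21 p := C p * D1 S p - S p * D1 C p.
pose n1 p := C p * D3 X p + S p * D3 Y p.
pose n2 p := C p * D3 S p - S p * D3 C p.
pose l p := S p * D3 X p - C p * D3 Y p.
have dm11 : diffable m11 by apply: diffableD; exact: diffableM.
have dm12 : diffable m12 by apply: diffableD; exact: diffableM.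
have dm21 : diffable m21 by apply: diffableB; exact: diffableM.
have dm22 : diffable m22 by apply: diffableB; exact: diffableM.
have dn1 : diffable n1 by apply: diffableD; exact: diffableM.
have dn2 : diffable n2 by apply: diffableB; exact: diffableM.
have dl : diffable l by apply: diffableB; exact: diffableM.
have F p : [/\ [/\ D1 X p = m11 p * C p, D1 Y p = m11 p * S p,
                   D1 C p = - (m21 p * S p) & D1 S p = m21 p * C p],
        [/\ D2 X p = m12 p * C p, D2 Y p = m12 p * S p, D2 C p = - (m22 p * S p) &
            D2 S p = m22 p * C p] &
        [/\ m11 p ^+ 2 + m21 p ^+ 2 = 1, m12 p ^+ 2 + m22 p ^+ 2 = 1 &
            m11 p * m12 p + m21 p * m22 p = 0]].
  have [a [b [a' [b' [[e1 e2 e3 e4] [f1 f2 f3 f4] orth]]]]] := frame p.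
  have cs := CS p.
  have E11 : m11 p = a.
    by rewrite /m11 e1 e2 -[RHS]mulr1 -cs; ring.
  have E21 : m21 p = b.
    by rewrite /m21 e3 e4 -[RHS]mulr1 -cs; ring.
  have E12 : m12 p = a'.
    by rewrite /m12 f1 f2 -[RHS]mulr1 -cs; ring.
  have E22 : m22 p = b'.
    by rewrite /m22 f3 f4 -[RHS]mulr1 -cs; ring.
  by rewrite E11 E21 E12 E22.
have Mul D f g : derivation D -> diffable f -> diffable g -> forall p,
    D (fun q => f q * g q) p = D f p * g p + f p * D g p.
  by move=> [_ DM _]; exact: DM.
have MulN D f g : derivation D -> diffable f -> diffable g -> forall p,
    D (fun q => - (f q * g q)) p = - (D f p * g p + f p * D g p).
  move=> dD df dg p; rewrite (@derivationN _ D (fun q => f q * g q))//.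
    by rewrite Mul.
  exact: diffableM.
have X1E : D1 X = fun p => m11 p * C p by apply/funext => p; case: (F p) => -[].
have Y1E : D1 Y = fun p => m11 p * S p by apply/funext => p; case: (F p) => -[].
have C1E : D1 C = fun p => - (m21 p * S p) by apply/funext => p; case: (F p) => -[].
have S1E : D1 S = fun p => m21 p * C p by apply/funext => p; case: (F p) => -[].
have X2E : D2 X = fun p => m12 p * C p by apply/funext => p; case: (F p) => _ [].
have Y2E : D2 Y = fun p => m12 p * S p by apply/funext => p; case: (F p) => _ [].
have C2E : D2 C = fun p => - (m22 p * S p) by apply/funext => p; case: (F p) => _ [].
have S2E : D2 S = fun p => m22 p * C p by apply/funext => p; case: (F p) => _ [].
have orth p := let: And3 _ _ o := F p in o.
have CS3 p : C p * D3 C p + S p * D3 S p = 0.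
  have [DD _ Dc] := d3.
  have := DD (fun q => C q * C q) (fun q => S q * S q) (diffableM dC dC) (diffableM dS dS) p.
  rewrite !Mul// (_ : (fun q => _) = fun=> 1); last first.
    by apply/funext => q; rewrite -(CS q) !expr2.
  by rewrite Dc; lra.
have X3E : D3 X = fun p => n1 p * C p + l p * S p.
  by apply/funext => p; rewrite /n1 /l -[LHS]mul1r -(CS p); ring.
have Y3E : D3 Y = fun p => n1 p * S p - l p * C p.
  by apply/funext => p; rewrite /n1 /l -[LHS]mul1r -(CS p); ring.
have C3E : D3 C = fun p => - (n2 p * S p).
  apply/funext => p; rewrite /n2 -[LHS]mul1r -(CS p).
  rewrite (_ : _ * _ = C p * (C p * D3 C p + S p * D3 S p) -
    (C p * D3 S p - S p * D3 C p) * S p); last by ring.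
  by rewrite CS3 mulr0 sub0r.
have S3E : D3 S = fun p => n2 p * C p.
  apply/funext => p; rewrite /n2 -[LHS]mul1r -(CS p).
  rewrite (_ : _ * _ = S p * (C p * D3 C p + S p * D3 S p) +
    (C p * D3 S p - S p * D3 C p) * C p); last by ring.
  by rewrite CS3 mulr0 add0r.
have C1p p : D1 C p = - (m21 p * S p) by rewrite C1E.
have S1p p : D1 S p = m21 p * C p by rewrite S1E.
have C2p p : D2 C p = - (m22 p * S p) by rewrite C2E.
have S2p p : D2 S p = m22 p * C p by rewrite S2E.
have C3p p : D3 C p = - (n2 p * S p) by rewrite C3E.
have S3p p : D3 S p = n2 p * C p by rewrite S3E.
(* The X3-component of [X1, X2] = X3: [l] is the determinant of the orthogonal matrix m, hence of
   square 1 and annihilated by every derivation. *)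
have lE p : l p = m11 p * m22 p - m12 p * m21 p.
  have [eX _ _] := brX p; have [eY _ _] := brY p.
  move: eX; rewrite X1E X2E X3E !Mul// C1p C2p => eX.
  move: eY; rewrite Y1E Y2E Y3E !Mul// S1p S2p => eY.
  have h : D1 m12 p - D2 m11 p - n1 p = 0 /\ m11 p * m22 p - m12 p * m21 p - l p = 0.
    by apply: (@rotation_coords0 (C p) (S p)) => //; lra.
  by case: h => _; lra.
have l2 p : l p * l p = 1.
  have [r1 r2 r3] := orth p.
  rewrite lE (_ : _ * _ = (m11 p ^+ 2 + m21 p ^+ 2) * (m12 p ^+ 2 + m22 p ^+ 2) -
    (m11 p * m12 p + m21 p * m22 p) ^+ 2); last by ring.
  by rewrite r1 r2 r3; ring.
have l1 p : D1 l p = 0 by exact: derivation_unit.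
have l2' p : D2 l p = 0 by exact: derivation_unit.
have l3 p : D3 l p = 0 by exact: derivation_unit.
have AddX D p : derivation D -> D (fun q => n1 q * C q + l q * S q) p =
    D n1 p * C p + n1 p * D C p + (D l p * S p + l p * D S p).
  by move=> dD; exact: derivation_lincomb.
have SubY D p : derivation D -> D (fun q => n1 q * S q - l q * C q) p =
    D n1 p * S p + n1 p * D S p - (D l p * C p + l p * D C p).
  move=> dD; rewrite (derivationB p dD (diffableM dn1 dS) (diffableM dl dC)).
  by rewrite !Mul.
have B23 p : (D2 n1 p + l p * m22 p - D3 m12 p - m11 p = 0) /\
             m12 p * n2 p - n1 p * m22 p = 0.
  have [_ eX _] := brX p; have [_ eY _] := brY p.
  move: eX; rewrite X1E X2E X3E AddX// Mul// C2p S2p C3p l2' => eX.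
  move: eY; rewrite Y1E Y2E Y3E SubY// Mul// C2p S2p S3p l2' => eY.
  by apply: (@rotation_coords0 (C p) (S p)) => //; lra.
have B13 p : (D1 n1 p + l p * m21 p - D3 m11 p = 0) /\
             m11 p * n2 p - n1 p * m21 p = 0.
  have [_ _ eX] := brX p; have [_ _ eY] := brY p.
  move: eX; rewrite X1E X3E AddX// Mul// C1p S1p C3p l1 => eX.
  move: eY; rewrite Y1E Y3E SubY// Mul// C1p S1p S3p l1 => eY.
  by apply: (@rotation_coords0 (C p) (S p)) => //; lra.
(* The X3-components of the other two brackets form a homogeneous linear system in [n1], [n2] whose
   determinant is [l] up to sign. *)
have n10 p : n1 p = 0.
  have [_ b1] := B13 p; have [_ b2] := B23 p.
  rewrite -[n1 p]mul1r -(l2 p) -mulrA {2}lE.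
  rewrite (_ : _ * n1 p = m12 p * (m11 p * n2 p - n1 p * m21 p) -
     m11 p * (m12 p * n2 p - n1 p * m22 p)); last by ring.
  by rewrite b1 b2; ring.
have n20 p : n2 p = 0.
  have [_ b1] := B13 p; have [_ b2] := B23 p.
  rewrite -[n2 p]mul1r -(l2 p) -mulrA {2}lE.
  rewrite (_ : _ * n2 p = m22 p * (m11 p * n2 p - n1 p * m21 p) -
     m21 p * (m12 p * n2 p - n1 p * m22 p)); last by ring.
  by rewrite b1 b2; ring.
have n1E : n1 = fun=> 0 by exact/funext.
have n2E : n2 = fun=> 0 by exact/funext.
(* In an orthogonal matrix of determinant [l] the second column is [l] times the first one turned by
   a right angle. *)
have m22E : m22 = fun p => l p * m11 p.
  apply/funext => p; have [r1 r2 r3] := orth p.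
  rewrite lE -[LHS]mulr1 -r1.
  rewrite (_ : _ * _ = m21 p * (m11 p * m12 p + m21 p * m22 p) +
    (m11 p * m22 p - m12 p * m21 p) * m11 p); last by ring.
  by rewrite r3 mulr0 add0r.
have m12E p : m12 p = - (l p * m21 p).
  have [r1 r2 r3] := orth p.
  rewrite lE -[LHS]mulr1 -r1.
  rewrite (_ : _ * _ = m11 p * (m11 p * m12 p + m21 p * m22 p) -
    (m11 p * m22 p - m12 p * m21 p) * m21 p); last by ring.
  by rewrite r3 mulr0 sub0r.
have m11_3 p : D3 m11 p = l p * m21 p.
  have [b1 _] := B13 p; have [_ _ Dc] := d1.
  by move: b1; rewrite n1E Dc; lra.
have m22_3 p : D3 m22 p = - m21 p.
  have [_ eC _] := brC p; have [_ eS _] := brS p.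
  move: eC; rewrite C1E C2E C3E !MulN// S3p n20 n2E => eC.
  move: eS; rewrite S1E S2E S3E !Mul// C3p n20 n2E => eS.
  have [_ _ Dc2] := d2; rewrite Dc2 in eC eS.
  have h : (0 : R) = 0 /\ D3 m22 p + m21 p = 0.
    by apply: (@rotation_coords0 (C p) (S p)) => //; lra.
  by case: h => _; lra.
(* Since [m22 = l m11] and [l] has zero derivative, [D3 m22] equals [l * l * m21], that is [m21];
   the angular component of [X2, X3] = X1 gives [- m21]. *)
have m210 p : m21 p = 0.
  have : D3 m22 p = m21 p.
    rewrite {1}m22E Mul// l3 m11_3 mul0r add0r mulrA l2 mul1r.
    by [].
  by rewrite m22_3; lra.
have m120 p : m12 p = 0 by rewrite m12E m210 mulr0 oppr0.
have lE' p : l p = m11 p * m22 p by rewrite lE m210 mulr0 subr0.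
split => //.
- by move=> p; have [r _ _] := orth p; rewrite m210 expr0n addr0 expr2 in r.
- by move=> p; have [_ r _] := orth p; rewrite m120 expr0n add0r expr2 in r.
move=> p; split; last split.
- by split; rewrite ?X1E ?Y1E ?C1E ?S1E// m210 mul0r ?oppr0.
- by split; rewrite ?X2E ?Y2E ?C2E ?S2E// m120 mul0r.
- by split; rewrite ?X3E ?Y3E ?C3E ?S3E ?n20 ?n10 ?mul0r ?oppr0// -lE' ?add0r ?sub0r.
Qed.

End Rigidity.

(** * Explicit form of the isometries *)

Section Isometries.
Context {R : realType}.
Local Notation V := (R * R * R)%type.
Implicit Types (p q v : V) (f g : V -> R) (phi : SE2 R -> SE2 R) (M : SE2 R).

Lemma derivation_rotated (D : (V -> R) -> V -> R) (C S c s : V -> R) (t : R) p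
    (C' S' c' s' : R) : derivation D ->
  diffable C -> diffable S -> diffable c -> diffable s ->
  D C p = C' -> D S p = S' -> D c p = c' -> D s p = s' ->
  D (fun q => C q * c q + S q * (t * s q)) p =
  C' * c p + C p * c' + (S' * (t * s p) + S p * (t * s')).
Proof.
move=> dD dC dS dc ds eC eS ec es.
have dts : diffable (fun q => t * s q) by apply: diffableM => //; exact: diffable_cst.
rewrite (derivation_lincomb p dD dC dc dS dts) eC eS ec.
have [_ DM Dc] := dD.
by rewrite (DM (fun=> t) s (diffable_cst t) ds p) Dc es mul0r add0r.
Qed.

Lemma derivation_affine (D : (V -> R) -> V -> R) (X x y : V -> R) (a b : R) p
    (X' x' y' : R) : derivation D -> diffable X -> diffable x -> diffable y ->
  D X p = X' -> D x p = x' -> D y p = y' ->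
  D (fun q => X q + (a * x q + b * y q)) p = X' + (a * x' + b * y').
Proof.
move=> dD dX dx dy eX ex ey.
have da := diffable_cst a; have db := diffable_cst b.
have [DD DM Dc] := dD.
rewrite (DD X (fun q => a * x q + b * y q)) //; last first.
  by apply: diffableD; exact: diffableM.
by rewrite (derivation_lincomb p dD da dx db dy) !Dc eX ex ey !mul0r !add0r.
Qed.

Lemma entry_twice_diffable (F : V -> 'M[R]_3) i j : Cinfty F ->
  twice_diffable (fun p => F p i j).
Proof.
move=> /(_ 2%N) [dF d2F].
have ent (G : V -> 'M[R]_3) : (forall p, differentiable G p) ->
    diffable (fun p => G p i j).
  move=> dG p; apply: (@differentiable_comp _ _ _ _ G (fun A : 'M[R]_3 => A i j)).
    exact: dG.
  exact: differentiable_coord.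
split; first exact: ent.
move=> v; rewrite (_ : 'D_v _ = fun p => 'D_v F p i j); last first.
  by apply/funext => p; rewrite derive_entry.
by apply: ent; have [] := d2F v.
Qed.

Lemma inner_isometry phi p u u' c : sr_isometry phi ->
  c = u.1 * u'.1 + u.2 * u'.2 ->
  inner (phi (se2 p)) (differential phi p (hvec p u)) (differential phi p (hvec p u')) c.
Proof. by move=> [_ _ h] cE; apply: h; exists p, u, u'; split. Qed.

Lemma tangent_hvec_entries p u :
  [/\ tangent p (hvec p u) 0 0 = - (u.2 * sin p.2),
      tangent p (hvec p u) 1 0 = u.2 * cos p.2,
      tangent p (hvec p u) 0 2 = u.1 * cos p.2 &
      tangent p (hvec p u) 1 2 = u.1 * sin p.2].
Proof.
rewrite tangentE derive_rigid_mx !mxE /hvec /X1 /X2 /= /GRing.scale/=.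
split; ring.
Qed.

(** [inner] only asserts that some coordinates and coefficients exist; uniqueness of the
    coefficients identifies those coming from different instances. *)
Lemma tangent_hvec_inj p q u u' : se2 p = se2 q ->
  tangent p (hvec p u) = tangent q (hvec q u') -> u = u'.
Proof.
move=> /se2_eqP[ec es _ _] e.
have [a1 a2 a3 a4] := tangent_hvec_entries p u.
have [b1 b2 b3 b4] := tangent_hvec_entries q u'.
rewrite e b1 -es in a1; rewrite e b2 -ec in a2; rewrite e b3 -ec in a3; rewrite e b4 -es in a4.
have cs := cos2Dsin2 p.2.
case: u u' a1 a2 a3 a4 {e b1 b2 b3 b4} => [u1 u2] [v1 v2]/= a1 a2 a3 a4.
congr (_, _).
  have h : u1 * (cos p.2 ^+ 2 + sin p.2 ^+ 2) = v1 * (cos p.2 ^+ 2 + sin p.2 ^+ 2).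
    rewrite !mulrDr !expr2 !mulrA -a3 -a4.
    by [].
  by move: h; rewrite cs !mulr1.
have h : u2 * (cos p.2 ^+ 2 + sin p.2 ^+ 2) = v2 * (cos p.2 ^+ 2 + sin p.2 ^+ 2).
  rewrite !mulrDr !expr2 !mulrA -a2.
  by congr (_ + _ * _); apply/oppr_inj; rewrite a1.
by move: h; rewrite cs !mulr1.
Qed.

(* The two signs record whether [phi] preserves or reverses each of the
   directions [X1] and [X2]. *)
Lemma isometry_form phi : sr_isometry phi ->
  let F p := set_val (phi (se2 p)) in
  exists c0 s0 x0 y0 s t : R, [/\ s ^+ 2 = 1, t ^+ 2 = 1 & forall p,
    [/\ F p 0 0 = c0 * cos p.2 - t * s0 * sin p.2,
        F p 1 0 = s0 * cos p.2 + t * c0 * sin p.2,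
        F p 0 2 = x0 + s * (c0 * p.1.1 - t * s0 * p.1.2) &
        F p 1 2 = y0 + s * (s0 * p.1.1 + t * c0 * p.1.2)]].
Proof.
move=> iso F.
pose c0 : R := F (0, 0, 0) 0 0; pose s0 : R := F (0, 0, 0) 1 0.
pose x0 : R := F (0, 0, 0) 0 2; pose y0 : R := F (0, 0, 0) 1 2.
have [[psi [_ _ smF _]] _ _] := iso.
pose C p : R := F p 0 0; pose S p : R := F p 1 0.
pose X p : R := F p 0 2; pose Y p : R := F p 1 2.
have tC : twice_diffable C by exact: entry_twice_diffable.
have tS : twice_diffable S by exact: entry_twice_diffable.
have tX : twice_diffable X by exact: entry_twice_diffable.
have tY : twice_diffable Y by exact: entry_twice_diffable.
have reg f : f = C \/ f = S \/ f = X \/ f = Y ->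
    [/\ diffable f, diffable (D1 f), diffable (D2 f), diffable (D3 f) &
    forall p, [/\ D1 (D2 f) p = D2 (D1 f) p + D3 f p,
      D2 (D3 f) p = D3 (D2 f) p + D1 f p & D1 (D3 f) p = D3 (D1 f) p]].
  move=> hf; have tf : twice_diffable f by case: hf => [->|[->|[->|->]]].
  split; [by case: tf|exact: diffable_D1|exact: diffable_D2|exact: diffable_D3|].
  by move=> p; exact: frame_brackets.
have coord p q : phi (se2 p) = se2 q ->
    [/\ C p = cos q.2, S p = sin q.2, X p = q.1.1 & Y p = q.1.2].
  by move=> e; rewrite /C /S /X /Y /F e se2E; have [-> -> -> ->] := rigid_mxE q.
have CS p : C p ^+ 2 + S p ^+ 2 = 1.
  by have [q /coord[-> -> _ _]] := se2_surj (phi (se2 p)); exact: cos2Dsin2.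
have ent p u i j : differential phi p (hvec p u) i j =
    u.1 * D1 (fun q => F q i j) p + u.2 * D2 (fun q => F q i j) p.
  rewrite /differential derive_entry; last by have [dF _] := smF 1%N; exact: dF.
  apply: derive_hvec; exact: (entry_twice_diffable i j smF).1.
have frame p : exists a b a' b',
    [/\ [/\ D1 X p = a * C p, D1 Y p = a * S p, D1 C p = - (b * S p) & D1 S p = b * C p],
        [/\ D2 X p = a' * C p, D2 Y p = a' * S p, D2 C p = - (b' * S p) & D2 S p = b' * C p] &
        [/\ a ^+ 2 + b ^+ 2 = 1, a' ^+ 2 + b' ^+ 2 = 1 & a * a' + b * b' = 0]].
  (* The three inner products of X1 and X2 give the orthogonality relations, once the coefficients
     of the three instances are matched. *)
  pose i1 : R * R := (1, 0); pose i2 : R * R := (0, 1).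
  have h11 : (1 : R) = i1.1 * i1.1 + i1.2 * i1.2 by rewrite /= mulr1 mulr0 addr0.
  have h22 : (1 : R) = i2.1 * i2.1 + i2.2 * i2.2 by rewrite /= mulr1 mulr0 add0r.
  have h12 : (0 : R) = i1.1 * i2.1 + i1.2 * i2.2 by rewrite /= mulr0 mul0r addr0.
  have [p1 [u [u' [e1 tu tu' n1]]]] := inner_isometry p iso h11.
  have [p2 [w [w' [e2 tw tw' n2]]]] := inner_isometry p iso h22.
  have [p3 [z [z' [e3 tz tz' n3]]]] := inner_isometry p iso h12.
  have uu' : u = u' by exact: (tangent_hvec_inj (erefl _) (etrans (esym tu) tu')).
  have ww' : w = w' by exact: (tangent_hvec_inj (erefl _) (etrans (esym tw) tw')).
  have zu : z = u by exact: (tangent_hvec_inj (etrans e3 (esym e1)) (etrans (esym tz) tu)).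
  have zw : z' = w by exact: (tangent_hvec_inj (etrans e3 (esym e2)) (etrans (esym tz') tw)).
  have [c1 s1 _ _] := coord p p1 (esym e1).
  have [c2 s2 _ _] := coord p p2 (esym e2).
  have [a1 a2 a3 a4] := tangent_hvec_entries p1 u.
  have [b1 b2 b3 b4] := tangent_hvec_entries p2 w.
  rewrite -tu ent /= mul1r mul0r addr0 -s1 in a1.
  rewrite -tu ent /= mul1r mul0r addr0 -c1 in a2.
  rewrite -tu ent /= mul1r mul0r addr0 -c1 in a3.
  rewrite -tu ent /= mul1r mul0r addr0 -s1 in a4.
  rewrite -tw ent /= mul1r mul0r add0r -s2 in b1.
  rewrite -tw ent /= mul1r mul0r add0r -c2 in b2.
  rewrite -tw ent /= mul1r mul0r add0r -c2 in b3.
  rewrite -tw ent /= mul1r mul0r add0r -s2 in b4.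
  exists u.1, u.2, w.1, w.2; split; split => //.
  - by rewrite !expr2 n1 uu'.
  - by rewrite !expr2 n2 ww'.
  - by rewrite n3 zu zw.
have := frame_rigidity derivation_D1 derivation_D2 derivation_D3 reg CS frame.
set m1 := fun p => C p * D1 X p + S p * D1 Y p.
set m2 := fun p => C p * D2 S p - S p * D2 C p.
move=> [dm1 dm2 m11 m22 H].
have m1c p : m1 p = m1 (0, 0, 0).
  apply: constant_of_frame => // q.
  - exact: (derivation_unit q derivation_D1 dm1 m11).
  - exact: (derivation_unit q derivation_D2 dm1 m11).
  - exact: (derivation_unit q derivation_D3 dm1 m11).
have m2c p : m2 p = m2 (0, 0, 0).
  apply: constant_of_frame => // q.
  - exact: (derivation_unit q derivation_D1 dm2 m22).
  - exact: (derivation_unit q derivation_D2 dm2 m22).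
  - exact: (derivation_unit q derivation_D3 dm2 m22).
pose s := m1 (0, 0, 0); pose t := m2 (0, 0, 0).
have ss : s ^+ 2 = 1 by rewrite expr2; exact: m11.
have tt : t ^+ 2 = 1 by rewrite expr2; exact: m22.
exists c0, s0, x0, y0, s, t; split => //.
have {}H p : [/\ D1 X p = s * C p, D1 Y p = s * S p, D1 C p = 0 & D1 S p = 0] /\
      [/\ D2 X p = 0, D2 Y p = 0, D2 C p = - (t * S p) & D2 S p = t * C p] /\
      [/\ D3 X p = s * t * S p, D3 Y p = - (s * t * C p), D3 C p = 0 & D3 S p = 0].
  by have := H p; rewrite m1c m2c.
clearbody s t; clear m1c m2c m11 m22 dm1 dm2 m1 m2 frame ent reg.
have [dC _] := tC; have [dS _] := tS; have [dX _] := tX; have [dY _] := tY.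
(* As [t] is a sign, [P] and [Q] are the cosine and sine of the image angle minus [t] times the
   original angle, a difference that should be constant. *)
pose P q := C q * cos q.2 + S q * (t * sin q.2).
pose Q q := S q * cos q.2 + C q * (- t * sin q.2).
have dts a : diffable (fun q => a * sin q.2).
  by apply: diffableM; [exact: diffable_cst|exact: diffable_sin].
have dP : diffable P.
  apply: diffableD; apply: diffableM => //; exact: diffable_cos.
have dQ : diffable Q.
  apply: diffableD; apply: diffableM => //; exact: diffable_cos.
have Pc p : P p = c0.
  rewrite (constant_of_frame dP) => [|q|q|q].
  - by rewrite /P /= cos0 sin0 mulr1 !mulr0 addr0.
  - have [[_ _ h1 h2] _] := H q.
    have E := derivation_rotated t derivation_D1 dC dS diffable_cos
      diffable_sin h1 h2 (D1_cos q) (D1_sin q).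
    by apply: (etrans E); rewrite !mul0r !mulr0 !addr0.
  - have [_ [[_ _ h1 h2] _]] := H q.
    have E := derivation_rotated t derivation_D2 dC dS diffable_cos
      diffable_sin h1 h2 (D2_cos q) (D2_sin q).
    apply: (etrans E); move: (C q) (S q) (cos q.2) (sin q.2) => *.
    by ring: tt.
  - have [_ [_ [_ _ h1 h2]]] := H q.
    have E := derivation_rotated t derivation_D3 dC dS diffable_cos
      diffable_sin h1 h2 (D3_cos q) (D3_sin q).
    by apply: (etrans E); rewrite !mul0r !mulr0 !addr0.
have Qc p : Q p = s0.
  rewrite (constant_of_frame dQ) => [|q|q|q].
  - by rewrite /Q /= cos0 sin0 mulr1 !mulr0 addr0.
  - have [[_ _ h1 h2] _] := H q.
    have E := derivation_rotated (- t) derivation_D1 dS dC diffable_cos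
      diffable_sin h2 h1 (D1_cos q) (D1_sin q).
    by apply: (etrans E); rewrite !mul0r !mulr0 !addr0.
  - have [_ [[_ _ h1 h2] _]] := H q.
    have E := derivation_rotated (- t) derivation_D2 dS dC diffable_cos
      diffable_sin h2 h1 (D2_cos q) (D2_sin q).
    apply: (etrans E); move: (C q) (S q) (cos q.2) (sin q.2) => *.
    by ring: tt.
  - have [_ [_ [_ _ h1 h2]]] := H q.
    have E := derivation_rotated (- t) derivation_D3 dS dC diffable_cos
      diffable_sin h2 h1 (D3_cos q) (D3_sin q).
    by apply: (etrans E); rewrite !mul0r !mulr0 !addr0.
have CE p : C p = c0 * cos p.2 - t * s0 * sin p.2.
  rewrite -(Pc p) -(Qc p) /P /Q; have := cos2sin2 p.2.
  move: (C p) (S p) (cos p.2) (sin p.2) => ? ? ? ? e.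
  by ring: e tt.
have SE p : S p = s0 * cos p.2 + t * c0 * sin p.2.
  rewrite -(Pc p) -(Qc p) /P /Q; have := cos2sin2 p.2.
  move: (C p) (S p) (cos p.2) (sin p.2) => ? ? ? ? e.
  by ring: e tt.
have dx : diffable (fun q : V => q.1.1) by exact: differentiable_x.
have dy : diffable (fun q : V => q.1.2) by exact: differentiable_y.
have dxy a b : diffable (fun q : V => a * q.1.1 + b * q.1.2).
  by apply: diffableD; apply: diffableM => //; exact: diffable_cst.
(* The expected linear part is subtracted from [X]; all three frame derivatives of the remainder
   vanish by the formulas for [C] and [S]. *)
have XE p : X p + (- (s * c0) * p.1.1 + s * t * s0 * p.1.2) = x0.
  rewrite (@constant_of_frame _ (fun p => X p + (- (s * c0) * p.1.1 + s * t * s0 * p.1.2))) => [||q|q|q].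
  - by rewrite /= !mulr0 !addr0.
  - exact: diffableD.
  - have [[h _ _ _] _] := H q.
    have E := derivation_affine (- (s * c0)) (s * t * s0) derivation_D1 dX dx dy h (D1_x q) (D1_y q).
    apply: (etrans E); rewrite CE.
    move: (cos q.2) (sin q.2) => ? ?; by ring.
  - have [_ [[h _ _ _] _]] := H q.
    have E := derivation_affine (- (s * c0)) (s * t * s0) derivation_D2 dX dx dy h (D2_x q) (D2_y q).
    by apply: (etrans E); rewrite !mulr0 !addr0.
  - have [_ [_ [h _ _ _]]] := H q.
    have E := derivation_affine (- (s * c0)) (s * t * s0) derivation_D3 dX dx dy h (D3_x q) (D3_y q).
    apply: (etrans E); rewrite SE.
    move: (cos q.2) (sin q.2) => ? ?; by ring: tt.
have YE p : Y p + (- (s * s0) * p.1.1 + - (s * t * c0) * p.1.2) = y0.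
  rewrite (@constant_of_frame _ (fun p => Y p + (- (s * s0) * p.1.1 + - (s * t * c0) * p.1.2))) => [||q|q|q].
  - by rewrite /= !mulr0 !addr0.
  - exact: diffableD.
  - have [[_ h _ _] _] := H q.
    have E := derivation_affine (- (s * s0)) (- (s * t * c0)) derivation_D1 dY dx dy h (D1_x q) (D1_y q).
    apply: (etrans E); rewrite SE.
    move: (cos q.2) (sin q.2) => ? ?; by ring.
  - have [_ [[_ h _ _] _]] := H q.
    have E := derivation_affine (- (s * s0)) (- (s * t * c0)) derivation_D2 dY dx dy h (D2_x q) (D2_y q).
    by apply: (etrans E); rewrite !mulr0 !addr0.
  - have [_ [_ [_ h _ _]]] := H q.
    have E := derivation_affine (- (s * s0)) (- (s * t * c0)) derivation_D3 dY dx dy h (D3_x q) (D3_y q).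
    apply: (etrans E); rewrite CE.
    move: (cos q.2) (sin q.2) => ? ?; by ring: tt.
move=> p; split; [exact: CE|exact: SE|rewrite -[LHS]/(X p)|rewrite -[LHS]/(Y p)].
- by rewrite -(XE p); move: (X p) => ?; ring.
- by rewrite -(YE p); move: (Y p) => ?; ring.
Qed.

(** The group law lifted to coordinates in R^3; [rigid_mxM] matches it with the product of
    matrices. *)
Definition se2_mul p q : V :=
  (p.1.1 + cos p.2 * q.1.1 - sin p.2 * q.1.2,
   p.1.2 + sin p.2 * q.1.1 + cos p.2 * q.1.2, p.2 + q.2).

(** Composing the explicit form with itself squares both signs. The translating element can only be
    the image of the identity. *)
Lemma isometry_square phi : sr_isometry phi ->
  exists a, forall q, phi (phi (se2 q)) = se2 (se2_mul a q).
Proof.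
move=> iso; have [c0 [s0 [x0 [y0 [s [t [ss tt form]]]]]]] := isometry_form iso.
have {}form p q : phi (se2 p) = se2 q ->
    [/\ cos q.2 = c0 * cos p.2 - t * s0 * sin p.2,
        sin q.2 = s0 * cos p.2 + t * c0 * sin p.2,
        q.1.1 = x0 + s * (c0 * p.1.1 - t * s0 * p.1.2) &
        q.1.2 = y0 + s * (s0 * p.1.1 + t * c0 * p.1.2)].
  by move=> e; have := form p; rewrite e se2E; have [-> -> -> ->] := rigid_mxE q.
have twice q : exists q1 q2, phi (se2 q) = se2 q1 /\ phi (se2 q1) = se2 q2.
  have [q1 e1] := se2_surj (phi (se2 q)); have [q2 e2] := se2_surj (phi (se2 q1)).
  by exists q1, q2.
have [z1 [a [ez1 ea]]] := twice (0, 0, 0); exists a => q.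
have [q1 [q2 [e1 e2]]] := twice q; rewrite e1 e2; apply/se2_eqP.
have [cz1 sz1 xz1 yz1] := form _ _ ez1; have [ca sa xa ya] := form _ _ ea.
have [cq1 sq1 xq1 yq1] := form _ _ e1; have [cq2 sq2 xq2 yq2] := form _ _ e2.
rewrite /= cos0 sin0 in cz1 sz1 xz1 yz1.
rewrite /se2_mul /= cosD sinD ca sa xa ya cz1 sz1 xz1 yz1 cq2 sq2 xq2 yq2 cq1 sq1 xq1 yq1.
move: (cos q.2) (sin q.2) => ? ?.
by split; ring: ss tt.
Qed.

(** Each member is the square of the member at half the parameter; this takes the place of a
    connectedness argument on the signs. *)
Lemma one_parameter_translations (phi : R -> SE2 R -> SE2 R) :
  one_parameter_subgroup phi ->
  forall u, exists a, forall q, phi u (se2 q) = se2 (se2_mul a q).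
Proof.
move=> [iso _ add _] u; have [a ha] := isometry_square (iso (u / 2)).
by exists a => q; rewrite -ha -[RHS]/((phi (u / 2) \o phi (u / 2)) _) -add -splitr.
Qed.

End Isometries.

(** * Arcs of circles are not minimizing *)

Section RealDerivatives.
Context {R : realType}.
Implicit Types (f g : R -> R) (x a b : R).

Lemma is_derive1D f g x a b : is_derive x 1 f a -> is_derive x 1 g b ->
  is_derive x 1 (fun t => f t + g t) (a + b).
Proof. by move=> hf hg; exact: (is_deriveD hf hg). Qed.

Lemma is_derive1B f g x a b : is_derive x 1 f a -> is_derive x 1 g b ->
  is_derive x 1 (fun t => f t - g t) (a - b).
Proof. by move=> hf hg; exact: (is_deriveB hf hg). Qed.

Lemma is_derive1M f g x a b : is_derive x 1 f a -> is_derive x 1 g b ->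
  is_derive x 1 (fun t => f t * g t) (f x * b + g x * a).
Proof. by move=> hf hg; exact: (is_deriveM hf hg). Qed.

Lemma is_derive1Z f x a c : is_derive x 1 f a ->
  is_derive x 1 (fun t => c * f t) (c * a).
Proof. by move=> hf; exact: (is_deriveZ c hf). Qed.

Lemma derive1_continuous f (f' : R -> R) :
  (forall x, is_derive x (1 : R) f (f' x)) -> continuous f.
Proof.
move=> df x; apply: differentiable_continuous; apply/derivable1_diffP.
by have := df x; move=> /@ex_derive.
Qed.

Lemma pos_of_derive f (f' : R -> R) D :
  (forall x, is_derive x (1 : R) f (f' x)) -> f 0 = 0 ->
  (forall x, 0 < x -> x < D -> 0 < f' x) ->
  forall x, 0 < x -> x < D -> 0 < f x.
Proof.
move=> df f0 f'0 x x0 xD.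
have [|c /[!in_itv]/= /andP[c0 cx]] := MVT x0 (fun t _ => df t).
  by apply: continuous_subspaceT; exact: derive1_continuous df.
by rewrite f0 !subr0 => ->; rewrite mulr_gt0// f'0// (lt_trans cx).
Qed.

Lemma x_cos_lt_sin x : 0 < x -> x < 2 -> 0 < sin x - x * cos x.
Proof.
apply: (@pos_of_derive (fun x => sin x - x * cos x) (fun x => x * sin x)).
- move=> {}x.
  apply: (is_derive_eq (is_derive1B (is_derive_sin x)
    (is_derive1M (is_derive_id x 1) (is_derive_cos x)))).
  by rewrite /=; move: (cos x) (sin x) => *; ring.
- by rewrite sin0 mul0r subr0.
- by move=> {}x x0 x2; rewrite mulr_gt0// sin2_gt0// x0.
Qed.

(** This is the strict Cauchy-Schwarz inequality for cos and 1 on [-x, x], where cos has integral 2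
    sin x and its square has integral x + sin x cos x. *)
Lemma two_sin2_lt x : 0 < x -> x < 2 ->
  2 * sin x ^+ 2 < x * (x + sin x * cos x).
Proof.
move=> x0 x2; rewrite -subr_gt0; move: x x0 x2.
have dsc x : is_derive x 1 (fun x => sin x * cos x) (cos x ^+ 2 - sin x ^+ 2).
  apply: (is_derive_eq (is_derive1M (is_derive_sin x) (is_derive_cos x))).
  by move: (cos x) (sin x) => *; ring.
have dcc x : is_derive x 1 (fun x => cos x ^+ 2 - sin x ^+ 2) (- 4 * (sin x * cos x)).
  rewrite (_ : (fun x => _) = fun x => cos x * cos x - sin x * sin x)//.
  apply: (is_derive_eq (is_derive1B (is_derive1M (is_derive_cos x) (is_derive_cos x))
    (is_derive1M (is_derive_sin x) (is_derive_sin x)))).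
  by move: (cos x) (sin x) => *; ring.
apply: (@pos_of_derive (fun x => x * (x + sin x * cos x) - 2 * sin x ^+ 2)
  (fun x => 2 * x - 3 * (sin x * cos x) + x * (cos x ^+ 2 - sin x ^+ 2))).
- move=> x; rewrite (_ : (fun x => _) =
    fun x => x * (x + sin x * cos x) - 2 * (sin x * sin x))//.
  apply: (is_derive_eq (is_derive1B
    (is_derive1M (is_derive_id x 1) (is_derive1D (is_derive_id x 1) (dsc x)))
    (is_derive1Z 2 (is_derive1M (is_derive_sin x) (is_derive_sin x))))).
  by rewrite /=; move: (cos x) (sin x) => *; ring.
- by rewrite sin0; ring.
(* The second derivative factors, and its sign reduces to [x_cos_lt_sin]. *)
apply: (@pos_of_derive _ (fun x => 4 * (sin x * (sin x - x * cos x)))).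
- move=> x.
  apply: (is_derive_eq (is_derive1D (is_derive1B (is_derive1Z 2 (is_derive_id x 1))
    (is_derive1Z 3 (dsc x))) (is_derive1M (is_derive_id x 1) (dcc x)))).
  rewrite /=; have := cos2sin2 x.
  by move: (cos x) (sin x) => ? ? e; ring: e.
- by rewrite sin0 cos0; ring.
- move=> x x0 x2; rewrite mulr_gt0// mulr_gt0//; first by rewrite sin2_gt0// x0.
  exact: x_cos_lt_sin.
Qed.

End RealDerivatives.

(** * Strictly shorter competitors for arcs *)

Section Shortcut.
Context {R : realType}.
Notation mu := (@lebesgue_measure R).
Implicit Types (t d k r : R).

Lemma is_derive_turn (th k t : R) : is_derive t 1 (fun t => th + k * t) k.
Proof.
apply: (is_derive_eq (is_derive1D (is_derive_cst th t 1)
  (is_derive1Z k (is_derive_id t 1)))).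
by rewrite add0r mulr1.
Qed.

(* Among the curves [x' = rho cos th], [y' = rho sin th] parametrized by
   [th] and having the end points of the arc [rho = r], the energy
   [\int rho ^ 2] is minimized by [rho] proportional to [cos (th - thm)],
   where [thm] is the middle angle. *)
Lemma arc_shortcut_centered (xm ym thm d k r : R) : 0 < d -> d < 2 ->
  (k = 1 \/ k = -1) -> r != 0 -> exists q' v1 v2,
  [/\ horizontal (- d) d q' v1 v2,
      q' (- d) = se2 (xm - k * r * cos thm * sin d, ym - k * r * sin thm * sin d, thm - k * d),
      q' d = se2 (xm + k * r * cos thm * sin d, ym + k * r * sin thm * sin d, thm + k * d) &
      length (- d) d v1 v2 < Num.sqrt (1 + r ^+ 2) * (2 * d)].
Proof.
move=> d0 d2 k1 r0.
have kk : k ^+ 2 = 1 by case: k1 => ->; rewrite ?expr1n ?sqrrN ?expr1n.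
have ck t : cos (k * t) = cos t by case: k1 => ->; rewrite ?mul1r ?mulN1r ?cosN.
have sk t : sin (k * t) = k * sin t by case: k1 => ->; rewrite ?mul1r ?mulN1r ?sinN.
pose K := d + sin d * cos d.
have dK : 2 * sin d ^+ 2 < d * K by exact: two_sin2_lt.
have K0 : 0 < K.
  by rewrite -(pmulr_rgt0 _ d0); apply: le_lt_trans dK; rewrite mulr_ge0// sqr_ge0.
(* [K] is the integral of the squared cosine over [-d, d], so this amplitude produces the signed
   chord [2 * r * sin d] of the arc. *)
pose m := 2 * r * sin d / K.
have mK : m * K = 2 * r * sin d by rewrite /m divfK// gt_eqF.
have dsc t : is_derive t 1 (fun t => t + sin t * cos t) (2 * (cos t * cos t)).
  apply: (is_derive_eq (is_derive1D (is_derive_id t 1)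
    (is_derive1M (is_derive_sin t) (is_derive_cos t)))).
  rewrite /=; have := cos2sin2 t; rewrite !expr2.
  by move: (cos t) (sin t) => ? ? e; ring: e.
have dss t : is_derive t 1 (fun t => sin t * sin t) (2 * (cos t * sin t)).
  apply: (is_derive_eq (is_derive1M (is_derive_sin t) (is_derive_sin t))).
  by move: (cos t) (sin t) => *; ring.
pose v1 t := k * m * cos t; pose v2 (t : R) := k.
pose x t := xm + (k * cos thm * (m / 2) * (t + sin t * cos t) -
                  sin thm * (m / 2) * (sin t * sin t - sin d * sin d)).
pose y t := ym + (k * sin thm * (m / 2) * (t + sin t * cos t) +
                  cos thm * (m / 2) * (sin t * sin t - sin d * sin d)).
pose th t := thm + k * t.
have cosE t : cos (th t) = cos thm * cos t - k * (sin thm * sin t).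
  by rewrite /th cosD ck sk; move: (cos thm) (sin thm) (cos t) (sin t) => *; ring.
have sinE t : sin (th t) = sin thm * cos t + k * (cos thm * sin t).
  by rewrite /th sinD ck sk; move: (cos thm) (sin thm) (cos t) (sin t) => *; ring.
have dss' t : is_derive t 1 (fun t => sin t * sin t - sin d * sin d) (2 * (cos t * sin t)).
  by apply: (is_derive_eq (is_derive1B (dss t) (is_derive_cst (sin d * sin d) t 1))); rewrite subr0.
have dx t : is_derive t 1 x (v1 t * cos (th t)).
  apply: (is_derive_eq (is_derive1D (is_derive_cst xm t 1) (is_derive1B
    (is_derive1Z (k * cos thm * (m / 2)) (dsc t)) (is_derive1Z (sin thm * (m / 2)) (dss' t))))).
  rewrite cosE /v1; move: (cos thm) (sin thm) (cos t) (sin t) => ? ? ? ?.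
  by field: kk.
have dy t : is_derive t 1 y (v1 t * sin (th t)).
  apply: (is_derive_eq (is_derive1D (is_derive_cst ym t 1) (is_derive1D
    (is_derive1Z (k * sin thm * (m / 2)) (dsc t)) (is_derive1Z (cos thm * (m / 2)) (dss' t))))).
  rewrite sinE /v1; move: (cos thm) (sin thm) (cos t) (sin t) => ? ? ? ?.
  by field: kk.
have cth : continuous th by exact: derive1_continuous (is_derive_turn thm k).
have cv1 : continuous v1 by move=> t; apply: cvgM; [exact: cvg_cst|exact: continuous_cos].
have dd : - d <= d by lra.
exists (fun t => se2 (x t, y t, th t)), v1, v2; split.
- split.
  + by apply: measurable_funTS; exact: continuous_measurable_fun.
  + exact: measurable_cst.
  + exists (Num.max `|k * m| `|k|) => t _; rewrite /v1 /v2 normrM.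
    rewrite !le_max lexx orbT; split=> //.
    by apply/orP; left; rewrite ler_piMr// cos_max.
  + exists x, y, th => t tdd; split=> //.
    * apply: (@primitive_of_derivative _ (- d) d x (fun s => v1 s * cos (th s)) dd) => //.
      move=> s; apply: cvgM; first exact: cv1.
      by apply: continuous_comp; [exact: cth|exact: continuous_cos].
    * apply: (@primitive_of_derivative _ (- d) d y (fun s => v1 s * sin (th s)) dd) => //.
      move=> s; apply: cvgM; first exact: cv1.
      by apply: continuous_comp; [exact: cth|exact: continuous_sin].
    * apply: (@primitive_of_derivative _ (- d) d th v2 dd) => //.
      - exact: is_derive_turn.
      - by move=> s; exact: cvg_cst.
- congr (se2 (_, _, _)).
  + rewrite /x sinN cosN; move: mK; rewrite /K.
    move: (cos thm) (sin thm) (cos d) (sin d) => ct st cd sd e.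
    rewrite (_ : xm - _ = xm - k * ct * (2 * r * sd) / 2); last by field.
    by rewrite -e; field.
  + rewrite /y sinN cosN; move: mK; rewrite /K.
    move: (cos thm) (sin thm) (cos d) (sin d) => ct st cd sd e.
    rewrite (_ : ym - _ = ym - k * st * (2 * r * sd) / 2); last by field.
    by rewrite -e; field.
  + by rewrite /th mulrN.
- congr (se2 (_, _, _)).
  + rewrite /x; move: mK; rewrite /K.
    move: (cos thm) (sin thm) (cos d) (sin d) => ct st cd sd e.
    rewrite (_ : xm + k * r * ct * sd = xm + k * ct * (2 * r * sd) / 2); last by field.
    by rewrite -e; field.
  + rewrite /y; move: mK; rewrite /K.
    move: (cos thm) (sin thm) (cos d) (sin d) => ct st cd sd e.
    rewrite (_ : ym + k * r * st * sd = ym + k * st * (2 * r * sd) / 2); last by field.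
    by rewrite -e; field.
- set N := Num.sqrt (1 + r ^+ 2).
  have r2 : 0 < r ^+ 2 by rewrite exprn_even_gt0.
  have N2 : N ^+ 2 = 1 + r ^+ 2 by rewrite sqr_sqrtr//; lra.
  have N0 : 0 < N by rewrite sqrtr_gt0; lra.
  (* [N] is the speed of the arc parametrized by its angle, so AM-GM with weight [N] is sharp on the
     arc and lower energy yields lower length. [E] is a primitive of the bound [e]. *)
  pose e t := (2 * N)^-1 * (2 + r ^+ 2 + m ^+ 2 * (cos t * cos t)).
  pose E t := (2 * N)^-1 * ((2 + r ^+ 2) * t + m ^+ 2 / 2 * (t + sin t * cos t)).
  have dE t : is_derive t 1 E (e t).
    apply: (is_derive_eq (is_derive1Z (2 * N)^-1 (is_derive1D
      (is_derive1Z (2 + r ^+ 2) (is_derive_id t 1)) (is_derive1Z (m ^+ 2 / 2) (dsc t))))).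
    rewrite /e; congr (_ * _); move: (cos t) => ?; by field.
  have ce : continuous e.
    move=> t; apply: cvgM; first exact: cvg_cst.
    apply: cvgD; first exact: cvg_cst.
    apply: cvgM; first exact: cvg_cst.
    by apply: cvgM; exact: continuous_cos.
  have ddd : d \in `[- d, d] by rewrite in_itv/= lexx andbT.
  have le : length (- d) d v1 v2 <= \int[mu]_(t in `[- d, d]) e t.
    apply: le_Rintegral_bm.
    + apply: bounded_measurable_speed; first exact: bounded_measurable_continuous.
      exact: bounded_measurable_cst.
    + exact: bounded_measurable_continuous.
    + move=> t _; rewrite /speed /v1 /v2; set w := Num.sqrt _.
      have w2 : w ^+ 2 = 1 + m ^+ 2 * (cos t * cos t).
        rewrite sqr_sqrtr; last by rewrite addr_ge0 ?sqr_ge0.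
        by move: (cos t) => ?; ring: kk.
      (* AM-GM: [2 N w <= N ^ 2 + w ^ 2] *)
      rewrite /e mulrC ler_pdivlMr ?mulr_gt0//.
      have : 0 <= (N - w) ^+ 2 by rewrite sqr_ge0.
      have -> : (N - w) ^+ 2 = N ^+ 2 + w ^+ 2 - w * (2 * N) by ring.
      by rewrite N2 w2; lra.
  apply: le_lt_trans le _.
  have := primitive_of_derivative dd dE ce ddd; rewrite /E sinN cosN.
  move=> h; have -> : \int[mu]_(t in `[- d, d]) e t =
      (2 * N)^-1 * ((2 + r ^+ 2) * (2 * d) + m * (m * K)).
    move: h; rewrite /K; set I := Rintegral _ _ _.
    move: (cos d) (sin d) => cd sd h.
    apply/(addrI ((2 * N)^-1 * ((2 + r ^+ 2) * - d + m ^+ 2 / 2 * (- d + - sd * cd)))).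
    by rewrite -h; field; rewrite gt_eqF.
  rewrite mulrC ltr_pdivrMr ?mulr_gt0// mK.
  rewrite (_ : N * _ * _ = 4 * d * N ^+ 2); last by ring.
  rewrite N2 /m.
  have : r ^+ 2 * (2 * sin d ^+ 2) < r ^+ 2 * (d * K) by rewrite ltr_pM2l.
  rewrite (_ : _ + _ = (2 + r ^+ 2) * (2 * d) + 2 * (r ^+ 2 * (2 * sin d ^+ 2)) / K); last first.
    by field; rewrite gt_eqF.
  move=> h2; have : 2 * (r ^+ 2 * (2 * sin d ^+ 2)) / K < 2 * r ^+ 2 * d.
    by rewrite ltr_pdivrMr//; move: h2; lra.
  by lra.
Qed.

(** The right-hand side is the length of the arc of signed radius [r] driven tangentially between
    the two points. The centred case applies with the middle angle, half the turn, and [k] the sense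
    of turning. *)
Lemma arc_shortcut (xa ya tha thb r : R) : tha != thb -> `|thb - tha| < 1 ->
  r != 0 -> exists a' b' q' v1 v2,
  [/\ a' <= b', horizontal a' b' q' v1 v2, q' a' = se2 (xa, ya, tha),
      q' b' = se2 (xa + r * (sin thb - sin tha), ya + r * (cos tha - cos thb), thb) &
      length a' b' v1 v2 < Num.sqrt (1 + r ^+ 2) * `|thb - tha|].
Proof.
move=> ab ab1 r0.
pose k : R := if tha < thb then 1 else -1.
have k1 : k = 1 \/ k = -1 by rewrite /k; case: ifP; [left|right].
pose d := `|thb - tha| / 2.
have kd : thb - tha = 2 * (k * d).
  rewrite /d /k; case: ltgtP ab => // [lt|lt] _.
    by rewrite gtr0_norm ?subr_gt0//; field.
  by rewrite ltr0_norm ?subr_lt0//; field.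
have d0 : 0 < d by rewrite divr_gt0// normr_gt0 subr_eq0 eq_sym.
pose thm := (tha + thb) / 2.
have ta : tha = thm - k * d by rewrite /thm; lra.
have tb : thb = thm + k * d by rewrite /thm; lra.
have ck : cos (k * d) = cos d by case: k1 => ->; rewrite ?mul1r ?mulN1r ?cosN.
have sk : sin (k * d) = k * sin d by case: k1 => ->; rewrite ?mul1r ?mulN1r ?sinN.
have d2 : d < 2 by rewrite /d; lra.
have [q' [v1 [v2 [hor qa qb len]]]] := arc_shortcut_centered
  (xa + k * r * cos thm * sin d) (ya + k * r * sin thm * sin d) thm d0 d2 k1 r0.
exists (- d), d, q', v1, v2; split=> //.
- by lra.
- by rewrite qa -ta !addrK.
- rewrite qb -tb; congr (se2 (_, _, _)); rewrite ta tb ?cosB ?cosD ?sinB ?sinD ck sk.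
    by move: (cos thm) (sin thm) (cos d) (sin d) => *; ring.
  by move: (cos thm) (sin thm) (cos d) (sin d) => *; ring.
- by rewrite (_ : `|_| = 2 * d)// /d; field.
Qed.

End Shortcut.

(** * Images of homogeneous geodesics *)

Section HomogeneousSets.
Context {R : realType}.
Local Notation V := (R * R * R)%type.
Implicit Types (m n p q : V) (G : set (SE2 R)).

Lemma se2_mul_congr m n q : se2 m = se2 n -> se2 (se2_mul m q) = se2 (se2_mul n q).
Proof.
by move=> /se2_eqP[e1 e2 e3 e4]; apply/se2_eqP; rewrite /se2_mul/= !cosD !sinD e1 e2 e3 e4.
Qed.

Lemma se2_mulr0 m : se2 (se2_mul m (0, 0, 0)) = se2 m.
Proof. by apply/se2_eqP; rewrite /se2_mul/= !mulr0 !addr0 subr0. Qed.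

(** The member of the group that carries the identity to a point [m] is left multiplication by [m].
    Addition of parameters therefore becomes the group law on G, and its commutativity is
    inherited. *)
Lemma homogeneous_orbit G : homogeneous G -> G (se2 (0, 0, 0)) ->
  [/\ forall m n, G (se2 m) -> G (se2 n) -> G (se2 (se2_mul m n)),
      forall m n, G (se2 m) -> G (se2 n) -> se2 (se2_mul m n) = se2 (se2_mul n m) &
      forall m, G (se2 m) ->
        exists2 n, G (se2 n) & se2 (se2_mul m n) = se2 (0, 0, 0)].
Proof.
move=> [phi [one inv trans]] G0; have tr := one_parameter_translations one.
have [_ phi0 add _] := one.
have orb m : G (se2 m) -> exists2 u, phi u (se2 (0, 0, 0)) = se2 m &
    forall q, phi u (se2 q) = se2 (se2_mul m q).
  move=> Gm; have [u hu] := trans _ _ G0 Gm; exists u => // q.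
  have [a ha] := tr u; rewrite ha; apply: se2_mul_congr.
  by rewrite -hu ha se2_mulr0.
have inG u : G (phi u (se2 (0, 0, 0))) by apply: (inv u); exists (se2 (0, 0, 0)).
have mulE m n u v : phi u (se2 (0, 0, 0)) = se2 m ->
    phi v (se2 (0, 0, 0)) = se2 n -> (forall q, phi u (se2 q) = se2 (se2_mul m q)) ->
    phi (u + v) (se2 (0, 0, 0)) = se2 (se2_mul m n).
  by move=> hu hv hq; rewrite add /= hv hq.
split=> [m n /orb[u hu uq] /orb[v hv vq]|m n /orb[u hu uq] /orb[v hv vq]|m /orb[u hu uq]].
- by rewrite -(mulE _ _ _ _ hu hv uq).
- by rewrite -(mulE _ _ _ _ hu hv uq) addrC (mulE _ _ _ _ hv hu vq).
- have [n hn] := se2_surj (phi (- u) (se2 (0, 0, 0))); exists n; first by rewrite -hn.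
  by rewrite -(mulE _ _ _ _ hu hn uq) subrr phi0.
Qed.

(** Differences with [lo] fill [0, hi - lo], and every nonnegative real is an integer multiple of an
    element of that interval. *)
Lemma additive_interval_all (P : R -> Prop) (lo hi : R) : lo < hi ->
  (forall x y, P x -> P y -> P (x + y)) -> (forall x, P x -> P (- x)) ->
  (forall x, lo <= x -> x <= hi -> P x) -> forall x, P x.
Proof.
move=> lohi PD PN Pint.
have Plo : P lo by apply: Pint => //; exact: ltW.
have P0 : P 0 by rewrite -(subrr lo); apply: PD => //; exact: PN.
have small x : 0 <= x -> x <= hi - lo -> P x.
  move=> x0 xd; rewrite -(addrK lo x); apply: PD; last exact: PN.
  by apply: Pint; lra.
have mul x (k : nat) : P x -> P (x *+ k).
  by move=> Px; elim: k => [|k IH]; rewrite ?mulr0n// mulrS; exact: PD.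
have pos x : 0 <= x -> P x.
  move=> x0; have d0 : 0 < hi - lo by rewrite subr_gt0.
  pose k := (Num.truncn (x / (hi - lo))).+1.
  have hk : x / (hi - lo) < k%:R by exact: truncnS_gt.
  have k0 : (0 : R) < k%:R by rewrite ltr0n.
  have -> : x = (x / k%:R) *+ k by rewrite -mulr_natr divfK// gt_eqF.
  apply: mul; apply: small; first by rewrite divr_ge0// ltW.
  by rewrite ler_pdivrMr// mulrC -ler_pdivrMr// ltW.
move=> x; have [|/ltW x0] := leP 0 x; first exact: pos.
by rewrite -(opprK x); apply: PN; apply: pos; rewrite oppr_ge0.
Qed.

(** The intermediate value theorem supplies the interval, so a single short arc of the geodesic
    decides its whole image. *)
Lemma additive_path_all (P : R -> Prop) (f : R -> R) (b : R) : 0 <= b ->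
  {within `[0, b], continuous f} -> f b != f 0 ->
  (forall x y, P x -> P y -> P (x + y)) -> (forall x, P x -> P (- x)) ->
  (forall t, t \in `[0, b] -> P (f t)) -> forall x, P x.
Proof.
move=> b0 cf fb PD PN Pf.
have [lt|lt|e] := ltgtP (f 0) (f b); last by rewrite e eqxx in fb.
- apply: (additive_interval_all lt) => // x x1 x2.
  have [|c cab <-] := @IVT R f 0 b x b0 cf; last exact: Pf.
  by rewrite ge_min le_max x1 x2 orbT.
- apply: (additive_interval_all lt) => // x x1 x2.
  have [|c cab <-] := @IVT R f 0 b x b0 cf; last exact: Pf.
  by rewrite ge_min le_max x1 x2 orbT.
Qed.

(* [(c1, c2)] is the fixed point of the rigid motion [m], and the conclusion
   says that [n] fixes it too. *)
Lemma common_centre m : cos m.2 != 1 -> exists c1 c2 : R, forall n,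
  se2 (se2_mul m n) = se2 (se2_mul n m) ->
  n.1.1 = c1 - c1 * cos n.2 + c2 * sin n.2 /\
  n.1.2 = c2 - c1 * sin n.2 - c2 * cos n.2.
Proof.
move=> cm; set c := cos m.2; set s := sin m.2.
have D0 : 1 - c != 0 by rewrite subr_eq0 eq_sym.
(* Solution of (1 - rotation) centre = translation part; the determinant is (1 - c)^2 + s^2 = 2 (1 -
   c). *)
exists (((1 - c) * m.1.1 - s * m.1.2) / (2 * (1 - c))),
       ((s * m.1.1 + (1 - c) * m.1.2) / (2 * (1 - c))) => n.
move=> /se2_eqP[_ _]; rewrite /se2_mul/= -/c -/s.
have cs : s ^+ 2 = 1 - c ^+ 2 by exact: sin2cos2.
move: (cos n.2) (sin n.2) (n.1.1) (n.1.2) (m.1.1) (m.1.2) => cn sn nx ny mx my.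
move=> e1 e2.
have f1 : (1 - c) * nx + s * ny = (1 - cn) * mx + sn * my by lra.
have f2 : (1 - c) * ny - s * nx = (1 - cn) * my - sn * mx by lra.
have DD : 2 * (1 - c) != 0 by rewrite mulf_neq0.
have g1 : 2 * (1 - c) * nx = (1 - c) * ((1 - cn) * mx + sn * my) - s * ((1 - cn) * my - sn * mx).
  by rewrite -f1 -f2; ring: cs.
have g2 : 2 * (1 - c) * ny = s * ((1 - cn) * mx + sn * my) + (1 - c) * ((1 - cn) * my - sn * mx).
  by rewrite -f1 -f2; ring: cs.
split; apply: (mulfI DD).
- by rewrite g1; field.
- by rewrite g2; field.
Qed.

End HomogeneousSets.

(** * Homogeneous geodesics without and with rotation *)

Section HomogeneousGeodesics.
Context {R : realType}.
Notation mu := (@lebesgue_measure R).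
Local Notation V := (R * R * R)%type.
Variable g : R -> SE2 R.

(** Unit speed makes the arc of length [b], whereas a closed arc would compete with the constant
    curve, of length 0. *)
Lemma minimizer_moves (b : R) (u1 u2 : R -> R) : 0 < b -> minimizer 0 b g ->
  horizontal 0 b g u1 u2 -> {ae mu, forall t, speed u1 u2 t = 1} ->
  g 0 != g b.
Proof.
move=> b0 [_ min] hor sp; apply/eqP => g0b.
have [p gp] := se2_surj (g 0).
have hor0 : horizontal 0 0 g (fun=> 0) (fun=> 0).
  split; [exact: measurable_cst|exact: measurable_cst|exists 0 => t _; rewrite normr0//|].
  exists (fun=> p.1.1), (fun=> p.1.2), (fun=> p.2) => t.
  rewrite in_itv/= -eq_le => /eqP <-; rewrite !Rintegral_itv1 !addr0; split => //.
  by rewrite gp; case: p {gp} => -[].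
have := min _ _ hor 0 0 g _ _ (lexx _) hor0 erefl g0b.
rewrite {2}/length Rintegral_itv1 /length (@eq_Rintegral_ae _ 0 b _ (fun=> 1)).
- by rewrite Rintegral_itv_cst; [rewrite mul1r subr0; lra|exact: ltW].
- by have [? ?] := horizontal_controls hor; exact: bounded_measurable_speed.
- exact: bounded_measurable_cst.
- apply: filterS sp; first exact: (ae_filter_ringOfSetsType mu).
  by move=> t ->.
Qed.

(** The bound [b < 1] keeps the rotation along the arc below 1, as [arc_shortcut] demands. *)
Lemma geodesic_start : arclength_geodesic g -> exists b u1 u2,
  [/\ 0 < b, b < 1, minimizer 0 b g, (forall a b, a <= b -> horizontal a b g u1 u2) &
      {ae mu, forall t, speed u1 u2 t = 1}].
Proof.
move=> [[u1 [u2 [hor sp]]] loc]; have [e e0 he] := loc 0.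
exists (Num.min e 1 / 2), u1, u2.
have m0 : 0 < Num.min e 1 by rewrite lt_min e0 ltr01.
have me : Num.min e 1 <= e by rewrite ge_min lexx.
have m1 : Num.min e 1 <= 1 by rewrite ge_min lexx orbT.
by split => //; [lra|lra|apply: he; lra].
Qed.

Lemma homogeneous_without_rotation : arclength_geodesic g -> g 0 = se2 (0, 0, 0) ->
  homogeneous (range g) -> (forall m, range g (se2 m) -> cos m.2 = 1) ->
  range g = [set se2 (t, 0, 0) | t in [set: R]].
Proof.
move=> geo g0 hom rot.
have G0 : range g (se2 (0, 0, 0)) by exists 0.
have [GM _ GV] := homogeneous_orbit hom G0.
have [b [u1 [u2 [b0 b1 min hor sp]]]] := geodesic_start geo.
(* With sin th = 0 the equation for y makes it constant. Since lifts belong to a compact interval,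
   this is stated for any interval and then used on either side of 0. *)
have flat a c : a <= c -> forall t, t \in `[a, c] -> exists2 x, g t = se2 (x, set_val (g a) 1 2, 0) & True.
  move=> ac t tac; have [_ _ _ [x [y [th h]]]] := hor a c ac.
  have th1 s : s \in `[a, c] -> cos (th s) = 1 /\ sin (th s) = 0.
    move=> sac; have [gs _ _ _] := h s sac.
    have c1 : cos (th s) = 1 by apply: (rot (x s, y s, th s)); rewrite -gs; exists s.
    by split => //; apply: cos1sin0; rewrite c1 normr1.
  have aac : a \in `[a, c] by rewrite in_itv/= lexx.
  have [gt _ yt _] := h t tac; have [ga _ _ _] := h a aac.
  exists (x t) => //; rewrite gt; apply/se2_eqP; have [c1 s1] := th1 t tac.
  rewrite /= c1 s1 cos0 sin0; split => //.
  rewrite ga se2E; have [_ _ _ -> /=] := rigid_mxE (x a, y a, th a).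
  rewrite yt (@eq_Rintegral _ _ _ _ _ (fun=> 0)) ?Rintegral_cst// ?mul0r ?addr0//.
  move=> s; rewrite inE/= => sat.
  have sac : s \in `[a, c].
    by move: sat tac; rewrite !in_itv/= => /andP[-> st] /andP[_ /(le_trans st)].
  by have [_ ->] := th1 s sac; rewrite mulr0.
have y0 : set_val (g 0) 1 2 = 0.
  by rewrite g0 se2E; have [_ _ _ ->] := @rigid_mxE R (0, 0, 0).
have on t : exists x, g t = se2 (x, 0, 0).
  have [t0|/ltW t0] := leP 0 t.
    have [|x gt _] := flat 0 t t0 t; first by rewrite in_itv/= t0 lexx.
    by exists x; rewrite gt y0.
  have [|x gt _] := flat t 0 t0 t; first by rewrite in_itv/= t0 lexx.
  have [|x' g0' _] := flat t 0 t0 0; first by rewrite in_itv/= t0 lexx.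
  exists x; rewrite gt; move: g0'; rewrite g0 => /se2_eqP[_ _ _ /= <-].
  by [].
apply/seteqP; split=> [_ [t _ <-]|_ [z _ <-]].
  by have [x ->] := on t; exists x.
have [_ _ _ [x [y [th h]]]] := hor 0 b (ltW b0).
have b00 : (0 : R) \in `[0, b] by rewrite in_itv/= lexx ltW.
have bb : b \in `[0, b] by rewrite in_itv/= lexx ltW.
have xE t : t \in `[0, b] -> g t = se2 (x t, 0, 0).
  move=> tb; have [gt _ _ _] := h t tb; have [x' gt'] := on t.
  have /se2_eqP[_ _ /= -> _] : se2 (x t, y t, th t) = se2 (x', 0, 0) by rewrite -gt.
  exact: gt'.
have [bm1 bm2] := horizontal_controls (hor 0 b (ltW b0)).
apply: (@additive_path_all _ (fun x => range g (se2 (x, 0, 0))) x b).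
- exact: ltW.
- have thE t : t \in `[0, b] -> th t = th 0 + \int[mu]_(s in `[0, t]) u2 s by case/h.
  have cth := primitive_continuous (ltW b0) bm2 thE.
  apply: (primitive_continuous (ltW b0) (v := fun s => u1 s * cos (th s))).
    apply: bounded_measurableM => //.
    by apply: bounded_measurable_comp => //; [exact: continuous_cos|exists 1; exact: cos_max].
  by move=> t /h[].
- apply/eqP => xb.
  have := minimizer_moves b0 min (hor 0 b (ltW b0)) sp.
  by rewrite (xE _ b00) (xE _ bb) xb eqxx.
- move=> v w Gv Gw; have := GM _ _ Gv Gw; congr (range g _).
  by apply/se2_eqP; rewrite /se2_mul /= cos0 sin0 !mul1r !mul0r subr0 !addr0 cos0 sin0.
- move=> v Gv; have [n Gn /se2_eqP[]] := GV _ Gv.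
  rewrite /se2_mul /= cos0 sin0 !mul1r !mul0r subr0 !addr0 !add0r => e1 e2 e3 e4.
  rewrite (_ : se2 _ = se2 n)//; apply/se2_eqP; rewrite /= e1 e2 e4 cos0 sin0; split=> //.
  by lra.
- by move=> t tb; exists t => //; rewrite xE.
Qed.

Lemma homogeneous_with_rotation m : arclength_geodesic g -> g 0 = se2 (0, 0, 0) ->
  homogeneous (range g) -> range g (se2 m) -> cos m.2 != 1 ->
  range g = [set se2 (0, 0, t) | t in [set: R]].
Proof.
move=> geo g0 hom Gm cm.
have G0 : range g (se2 (0, 0, 0)) by exists 0.
have [GM GC GV] := homogeneous_orbit hom G0.
have [c1 [c2 centre]] := common_centre cm.
have {}centre n : range g (se2 n) ->
    n.1.1 = c1 - c1 * cos n.2 + c2 * sin n.2 /\ n.1.2 = c2 - c1 * sin n.2 - c2 * cos n.2.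
  by move=> Gn; apply: centre; exact: GC.
have [b [u1 [u2 [b0 b1 min hor0 sp]]]] := geodesic_start geo.
have lb := ltW b0; have hor := hor0 0 b lb.
have [bm1 bm2] := horizontal_controls hor.
have [_ _ _ [x [y [th h]]]] := hor.
have b00 : (0 : R) \in `[0, b] by rewrite in_itv/= lexx ltW.
have bb : b \in `[0, b] by rewrite in_itv/= lexx ltW.
have xyE t : t \in `[0, b] -> x t = c1 - c1 * cos (th t) + c2 * sin (th t) /\
    y t = c2 - c1 * sin (th t) - c2 * cos (th t).
  move=> tb; have [gt _ _ _] := h t tb.
  by apply: (centre (x t, y t, th t)); rewrite -gt; exists t.
have thE t : t \in `[0, b] -> th t = th 0 + \int[mu]_(s in `[0, t]) u2 s by case/h.
have cth := primitive_continuous lb bm2 thE.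
have bc : bounded_measurable 0 b (fun t => cos (th t)).
  by apply: bounded_measurable_comp => //; [exact: continuous_cos|exists 1; exact: cos_max].
have bs : bounded_measurable 0 b (fun t => sin (th t)).
  by apply: bounded_measurable_comp => //; [exact: continuous_sin|exists 1; exact: sin_max].
have bns : bounded_measurable 0 b (fun t => - sin (th t)).
  rewrite (_ : (fun t => - sin (th t)) = fun t => -1 * sin (th t)).
    by apply: bounded_measurableM => //; exact: bounded_measurable_cst.
  by apply/funext => t; rewrite mulN1r.
have bcst (c : R) w : bounded_measurable 0 b w -> bounded_measurable 0 b (fun t => c * w t).
  by move=> bw; apply: bounded_measurableM => //; exact: bounded_measurable_cst.
have sub f t : bounded_measurable 0 b f -> t \in `[0, b] -> bounded_measurable 0 t f.
  by rewrite in_itv/= => bf /andP[_ tb]; exact: bounded_measurableS bf.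
have b1c := bounded_measurableM bm1 bc; have b1s := bounded_measurableM bm1 bs.
have b2c := bounded_measurableM bm2 bc; have b2s := bounded_measurableM bm2 bns.
(* Differentiates, almost everywhere, a linear relation with the increments of cos th and sin th; it
   is applied to both equations of the circle about (c1, c2). *)
have lin v (k l : R) : bounded_measurable 0 b v -> (forall t, t \in `[0, b] ->
    \int[mu]_(s in `[0, t]) v s = k * \int[mu]_(s in `[0, t]) (u2 s * - sin (th s)) +
      l * \int[mu]_(s in `[0, t]) (u2 s * cos (th s))) ->
    {ae mu, forall t, t \in `]0, b[ ->
      v t - (k * (u2 t * - sin (th t)) + l * (u2 t * cos (th t))) = 0}.
  move=> bv vE; have bk := bcst k _ b2s; have bl := bcst l _ b2c.
  apply: (ae_eq0_of_primitive b0).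
    by apply: bounded_measurableB => //; exact: bounded_measurableD.
  move=> t tb; rewrite RintegralB_bm; [|exact: sub|].
    rewrite RintegralD_bm; [|exact: sub|exact: sub].
    rewrite !RintegralZ_bm; [|exact: sub|exact: sub].
    by rewrite vE// subrr.
  by apply: sub => //; exact: bounded_measurableD.
have aex : {ae mu, forall t, t \in `]0, b[ -> u1 t * cos (th t) -
    (- c1 * (u2 t * - sin (th t)) + c2 * (u2 t * cos (th t))) = 0}.
  apply: lin => // t tb; have [_ xt _ _] := h t tb.
  have := sin_primitive lb bm2 thE tb; have := cos_primitive lb bm2 thE tb.
  have [ext _] := xyE t tb; have [ex0 _] := xyE 0 b00.
  move: xt; rewrite ext ex0.
  set I1 := Rintegral _ _ _; set I2 := Rintegral _ _ _; set I3 := Rintegral _ _ _.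
  by move=> e1 e2 e3; rewrite e2 e3 in e1; lra.
have aey : {ae mu, forall t, t \in `]0, b[ -> u1 t * sin (th t) -
    (- c2 * (u2 t * - sin (th t)) + - c1 * (u2 t * cos (th t))) = 0}.
  apply: lin => // t tb; have [_ _ yt _] := h t tb.
  have := sin_primitive lb bm2 thE tb; have := cos_primitive lb bm2 thE tb.
  have [_ eyt] := xyE t tb; have [_ ey0] := xyE 0 b00.
  move: yt; rewrite eyt ey0.
  set I1 := Rintegral _ _ _; set I2 := Rintegral _ _ _; set I3 := Rintegral _ _ _.
  by move=> e1 e2 e3; rewrite e2 e3 in e1; lra.
(* The two equations are rotated by the current angle: the transverse component carries no control,
   and the component along X1 is [u1]. *)
have ae12 : {ae mu, forall t, t \in `]0, b[ -> c1 * u2 t = 0 /\ u1 t = c2 * u2 t}.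
  apply: filterS2 aex aey; first exact: (ae_filter_ringOfSetsType mu).
  move=> t ex ey tb; move: (ex tb) (ey tb); have := cos2sin2 (th t).
  move: (cos (th t)) (sin (th t)) (u1 t) (u2 t) => c s v w cs {}ex {}ey; split.
    have -> : c1 * w = c * (v * s - (- c2 * (w * - s) + - c1 * (w * c))) -
      s * (v * c - (- c1 * (w * - s) + c2 * (w * c))) by ring: cs.
    by rewrite ex ey; ring.
  apply/eqP; rewrite -subr_eq0; apply/eqP.
  have -> : v - c2 * w = s * (v * s - (- c2 * (w * - s) + - c1 * (w * c))) +
      c * (v * c - (- c1 * (w * - s) + c2 * (w * c))) by ring: cs.
  by rewrite ex ey; ring.
have gb : g 0 != g b by exact: minimizer_moves hor sp.
(* On the circle the position is a function of the angle, so equal angles would bring the arc back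
   to its start. *)
have thb : th b != th 0.
  apply/eqP => e; move/eqP: gb; apply.
  have [-> _ _ _] := h _ b00; have [-> _ _ _] := h _ bb.
  have [-> ->] := xyE _ b00; have [-> ->] := xyE _ bb.
  by rewrite e.
have bsp := bounded_measurable_speed bm1 bm2.
have len1 : length 0 b u1 u2 = b.
  rewrite /length (@eq_Rintegral_ae _ 0 b _ (fun=> 1))//.
  - by rewrite Rintegral_itv_cst// mul1r subr0.
  - exact: bounded_measurable_cst.
  - by apply: filterS sp => [|t -> //]; exact: (ae_filter_ringOfSetsType mu).
have dth : th b - th 0 = \int[mu]_(s in `[0, b]) u2 s.
  by rewrite (thE _ bb); ring.
have babs := bounded_measurable_norm bm2.
(* Otherwise [u2] vanishes almost everywhere and the angle does not change. *)
have c10 : c1 = 0.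
  apply/eqP; apply: contraT => c1n; exfalso; move/eqP: thb; apply.
  apply/eqP; rewrite -subr_eq0 dth (@eq_Rintegral_ae _ 0 b _ (fun=> 0))//.
  - by rewrite Rintegral_itv_cst// mul0r.
  - exact: bounded_measurable_cst.
  - apply: filterS ae12; first exact: (ae_filter_ringOfSetsType mu).
    move=> t e tb; have [/eqP + _] := e tb.
    by rewrite mulf_eq0 (negbTE c1n) /= => /eqP.
have dabs : `|th b - th 0| <= \int[mu]_(s in `[0, b]) `|u2 s|.
  rewrite dth; apply: le_normr_Rintegral => //.
  exact: bounded_measurable_integrable.
have lenN : length 0 b u1 u2 = Num.sqrt (1 + c2 ^+ 2) * \int[mu]_(s in `[0, b]) `|u2 s|.
  rewrite /length -RintegralZ_bm//; apply: eq_Rintegral_ae => //.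
    exact: bcst.
  apply: filterS ae12; first exact: (ae_filter_ringOfSetsType mu).
  move=> t e tb; have [_ e2] := e tb.
  rewrite /speed e2 -sqrtr_sqr -sqrtrM; last by rewrite addr_ge0 ?sqr_ge0.
  by congr Num.sqrt; ring.
have N1 : 1 <= Num.sqrt (1 + c2 ^+ 2).
  by rewrite -[leLHS]sqrtr1 ler_wsqrtr// lerDl sqr_ge0.
have I0 : 0 <= \int[mu]_(s in `[0, b]) `|u2 s| by apply: Rintegral_ge0.
(* The angle may a priori turn back and forth, but the integral of [|u2|] dominates the net
   rotation, which is all that the competitor has to realize. *)
have c20 : c2 = 0.
  apply/eqP; apply: contraT => c2n; exfalso.
  have d1 : `|th b - th 0| < 1.
    apply: le_lt_trans dabs _; apply: le_lt_trans b1.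
    apply: (@le_trans _ _ (length 0 b u1 u2)); last by rewrite len1.
    by rewrite lenN ler_peMl.
  have t0b : th 0 != th b by rewrite eq_sym.
  have [a' [b' [q' [v1 [v2 [ab' hor' qa qb lt']]]]]] := arc_shortcut (x 0) (y 0) t0b d1 c2n.
  have [_ mini] := min.
  have qa' : q' a' = g 0 by rewrite qa; have [-> _ _ _] := h _ b00.
  have qb' : q' b' = g b.
    rewrite qb; have [-> _ _ _] := h _ bb; congr (se2 (_, _, _)).
      have [-> _] := xyE _ b00; have [-> _] := xyE _ bb.
      by rewrite c10; ring.
    have [_ ->] := xyE _ b00; have [_ ->] := xyE _ bb.
    by rewrite c10; ring.
  have := mini _ _ hor _ _ _ _ _ ab' hor' qa' qb'.
  rewrite leNgt => /negP; apply; apply: lt_le_trans lt' _.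
  by rewrite lenN ler_wpM2l// (le_trans _ N1).
have spot n : range g (se2 n) -> se2 n = se2 (0, 0, n.2).
  by move=> /centre[e1 e2]; apply/se2_eqP; rewrite e1 e2 c10 c20 /= !mul0r !subr0 addr0.
apply/seteqP; split=> [_ [t _ <-]|_ [z _ <-]].
  have [n gn] := se2_surj (g t); exists n.2 => //.
  by rewrite gn -spot// -gn; exists t.
apply: (@additive_path_all _ (fun z => range g (se2 (0, 0, z))) th b) => //.
- move=> v w Gv Gw; have := GM _ _ Gv Gw; congr (range g _).
  by apply/se2_eqP; rewrite /se2_mul /= !mulr0 subr0 !addr0.
- move=> v Gv; have [n Gn /se2_eqP[]] := GV _ Gv.
  rewrite /se2_mul /= cos0 sin0 => e1 e2 _ _.
  rewrite (_ : se2 _ = se2 n)// (spot _ Gn); apply/se2_eqP => /=.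
  have nE : n.2 = (v + n.2) - v by ring.
  by rewrite nE (cosB _ v) (sinB _ v) e1 e2 cosN sinN; split => //; ring.
- move=> t tb; have [gt _ _ _] := h t tb.
  by rewrite -(spot (x t, y t, th t)) -?gt; exists t.
Qed.

Lemma homogeneous_geodesic_image : arclength_geodesic g -> g 0 = se2 (0, 0, 0) ->
  homogeneous (range g) ->
  range g = [set se2 (t, 0, 0) | t in [set: R]] \/
  range g = [set se2 (0, 0, t) | t in [set: R]].
Proof.
move=> geo g0 hom.
have [rot|] := pselect (forall m, range g (se2 m) -> cos m.2 = 1).
  by left; exact: homogeneous_without_rotation.
move=> /existsNP[m /not_implyP[Gm /eqP cm]]; right.
exact: homogeneous_with_rotation Gm cm.
Qed.

End HomogeneousGeodesics.

(** * Left translations *)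

Section LeftTranslations.
Context {R : realType}.
Local Notation V := (R * R * R)%type.
Implicit Types (a p q w : V) (M : SE2 R).

Lemma rigid_mxM a q : rigid_mx a *m rigid_mx q = rigid_mx (se2_mul a q).
Proof.
case: a q => -[ax ay] ath [[x y] th]; rewrite /se2_mul /=; apply/matrixP => i j.
rewrite !mxE !big_ord_recl big_ord0 !mxE /= cosD sinD.
move: (cos ath) (sin ath) (cos th) (sin th) => ca sa c s.
by case: i => -[|[|[|//]]] i; case: j => -[|[|[|//]]] j; rewrite /=; ring.
Qed.

Lemma translate_mem a M : rigid_mx a *m set_val M \in SE2 R.
Proof.
by have [q ->] := se2_surj M; rewrite se2E rigid_mxM; apply/mem_set; exists (se2_mul a q).
Qed.

(** Defined on matrices, so that independence of the representative of the angle is automatic. *)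
Definition translate a M : SE2 R := exist _ (rigid_mx a *m set_val M) (translate_mem a M).

Lemma translate_se2 a q : translate a (se2 q) = se2 (se2_mul a q).
Proof. by apply: val_inj; rewrite /= rigid_mxM. Qed.

Lemma mulmx_trig_affine (B A0 A1 A2 A3 A4 : 'M[R]_3) p :
  B *m trig_affine A0 A1 A2 A3 A4 p =
  trig_affine (B *m A0) (B *m A1) (B *m A2) (B *m A3) (B *m A4) p.
Proof.
rewrite /trig_affine !mulmxDr.
by congr (_ + _ + _ + _ + _); apply/esym; exact: scalemxAr.
Qed.

Lemma translate_fun a : (fun p => set_val (translate a (se2 p))) =
  trig_affine (rigid_mx a *m delta_mx 2 2) (rigid_mx a *m rot_cos)
    (rigid_mx a *m rot_sin) (rigid_mx a *m delta_mx 0 2) (rigid_mx a *m delta_mx 1 2).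
Proof.
apply/funext => p; rewrite -mulmx_trig_affine.
by rewrite -rigid_mx_trig_affine.
Qed.

Lemma smooth_translate a : smooth (translate a).
Proof. by rewrite /smooth translate_fun; exact: Cinfty_trig_affine. Qed.

Definition se2_inv a : V :=
  (- (cos a.2 * a.1.1 + sin a.2 * a.1.2), sin a.2 * a.1.1 - cos a.2 * a.1.2, - a.2).

Lemma translateK a : cancel (translate a) (translate (se2_inv a)).
Proof.
move=> M; have [q ->] := se2_surj M; rewrite !translate_se2.
apply/se2_eqP; rewrite /se2_mul /se2_inv /= addKr cosN sinN.
have := cos2sin2 a.2; move: (cos a.2) (sin a.2) => c s cs.
by split => //; ring: cs.
Qed.

Lemma translateVK a : cancel (translate (se2_inv a)) (translate a).
Proof.
move=> M; have [q ->] := se2_surj M; rewrite !translate_se2.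
apply/se2_eqP; rewrite /se2_mul /se2_inv /= addNKr cosN sinN.
have := cos2sin2 a.2; move: (cos a.2) (sin a.2) => c s cs.
by split => //; ring: cs.
Qed.

Lemma differential_translate a p w :
  differential (translate a) p w = rigid_mx a *m tangent p w.
Proof.
rewrite /differential translate_fun tangentE.
apply: (etrans (congr1 (fun F => F p) (derive_trig_affine _ _ _ _ _ w))).
have E := congr1 (fun F => F p) (@derive_trig_affine R 2 2 (delta_mx 2 2) rot_cos
  rot_sin (delta_mx 0 2) (delta_mx 1 2) w).
rewrite [X in _ = _ *m 'D_w X p]rigid_mx_trig_affine.
apply: (etrans _ (esym (congr1 (mulmx (rigid_mx a)) E))).
rewrite mulmx_trig_affine !mulmx0.
have e1 : w.1.1 *: (rigid_mx a *m (delta_mx 0 2 : 'M[R]_3)) +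
    w.1.2 *: (rigid_mx a *m (delta_mx 1 2 : 'M[R]_3)) =
    rigid_mx a *m (w.1.1 *: delta_mx 0 2 + w.1.2 *: delta_mx 1 2).
  by rewrite mulmxDr; congr (_ + _); exact: scalemxAr.
have e2 : w.2 *: (rigid_mx a *m rot_sin) = rigid_mx a *m (w.2 *: rot_sin).
  exact: scalemxAr.
have e3 : - w.2 *: (rigid_mx a *m rot_cos) = rigid_mx a *m (- w.2 *: rot_cos).
  exact: scalemxAr.
by rewrite e1 e2 e3.
Qed.

(** Left invariance of the frame: the coefficients [u] are unchanged, hence so are horizontality and
    inner products. *)
Lemma translate_tangent a p u : rigid_mx a *m tangent p (hvec p u) =
  tangent (se2_mul a p) (hvec (se2_mul a p) u).
Proof.
rewrite !tangentE !derive_rigid_mx.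
case: a p u => -[ax ay] ath [[x y] th] [u1 u2].
rewrite /hvec /X1 /X2 /se2_mul /=; apply/matrixP => i j.
rewrite !mxE !big_ord_recl big_ord0 !mxE /= /GRing.scale/= cosD sinD.
move: (cos ath) (sin ath) (cos th) (sin th) => ca sa c s.
by case: i => -[|[|[|//]]] i; case: j => -[|[|[|//]]] j; rewrite /=; ring.
Qed.

Lemma tangent_hvec_congr p q u : se2 p = se2 q ->
  tangent p (hvec p u) = tangent q (hvec q u).
Proof.
move=> /se2_eqP[e1 e2 _ _].
by rewrite !tangentE !derive_rigid_mx /hvec /X1 /X2 /= e1 e2.
Qed.

Lemma translate_isometry a : sr_isometry (translate a).
Proof.
split.
- exists (translate (se2_inv a)); split; [exact: translateK|exact: translateVK| |];
    exact: smooth_translate.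
- move=> p; apply/seteqP; split=> [_ [u _ <-]|_ [q [u [e ->]]]].
    exists (se2_mul a p), u; rewrite translate_se2; split => //.
    by rewrite differential_translate translate_tangent.
  exists u => //; rewrite differential_translate translate_tangent.
  by apply: tangent_hvec_congr; rewrite e translate_se2.
- move=> p v w c [q [u [u' [e tv tw cE]]]].
  have -> : v = u by exact: (tangent_hvec_inj (esym e) tv).
  have -> : w = u' by exact: (tangent_hvec_inj (esym e) tw).
  exists (se2_mul a p), u, u'; rewrite translate_se2 !differential_translate.
  by split; [|exact: translate_tangent|exact: translate_tangent|exact: cE].
Qed.

Lemma continuous_matrix (T : topologicalType) m n (F : T -> 'M[R]_(m.+1, n.+1)) :
  (forall i j, continuous (fun x => F x i j)) -> continuous F.
Proof.
move=> cF x; apply/cvg_ballP => e e0.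
have : \forall y \near x, forall i, forall j, ball (F x i j) e (F y i j).
  apply: filter_forall => i; apply: filter_forall => j.
  by have /cvg_ballP/(_ e e0) := cF i j x.
by apply: filterS => y h; split => // i j; exact: h.
Qed.

Lemma one_parameter_translate (f : R -> V) : continuous f ->
  se2 (f 0) = se2 (0, 0, 0) ->
  (forall s t, se2 (f (s + t)) = se2 (se2_mul (f s) (f t))) ->
  one_parameter_subgroup (fun s => translate (f s)).
Proof.
move=> cf f0 fD; split.
- by move=> s; exact: translate_isometry.
- apply/funext => M; have [q ->] := se2_surj M.
  rewrite translate_se2 (se2_mul_congr q f0); apply/se2_eqP.
  by rewrite /se2_mul /= cos0 sin0 !mul1r !mul0r !add0r subr0.
- move=> s t; apply/funext => M; have [q ->] := se2_surj M.
  rewrite /= !translate_se2 (se2_mul_congr q (fD s t)); apply/se2_eqP.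
  rewrite /se2_mul /= !(cosD, sinD).
  move: (cos (f s).2) (sin (f s).2) (cos (f t).2) (sin (f t).2) (cos q.2) (sin q.2) => *.
  by split; ring.
(* SE(2) carries the topology induced by the matrices, so continuity is checked on entries, which
   are sums of products of continuous functions. *)
- apply: continuous_comp_initial.
  apply: continuous_matrix => i j.
  have cr (k : 'I_3) : continuous (fun sq : R * SE2 R => rigid_mx (f sq.1) i k).
    move=> x; apply: (continuous_comp (f := fun sq : R * SE2 R => rigid_mx (f sq.1))
      (g := fun A : 'M[R]_3 => A i k)); last exact: coord_continuous.
    apply: (continuous_comp (f := fun sq : R * SE2 R => f sq.1) (g := rigid_mx)).
      by apply: (continuous_comp (f := fst) (g := f)); [exact: cvg_fst|exact: cf].
    rewrite rigid_mx_trig_affine; apply: differentiable_continuous.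
    exact: (@differentiable_trig_affine R 2 2).
  have cM (k : 'I_3) : continuous (fun sq : R * SE2 R => (set_val sq.2 : 'M[R]_3) k j).
    move=> x; apply: (continuous_comp (f := fun sq : R * SE2 R => set_val sq.2 : 'M[R]_3)
      (g := fun A : 'M[R]_3 => A k j)); last exact: coord_continuous.
    apply: (continuous_comp (f := snd) (g := set_val)); first exact: cvg_snd.
    exact: initial_continuous.
  rewrite (_ : (fun _ => _) = fun sq : R * SE2 R =>
      rigid_mx (f sq.1) i 0 * (set_val sq.2 : 'M[R]_3) 0 j +
      (rigid_mx (f sq.1) i 1 * (set_val sq.2 : 'M[R]_3) 1 j +
       rigid_mx (f sq.1) i 2 * (set_val sq.2 : 'M[R]_3) 2 j)).
    move=> x; apply: cvgD; first by apply: cvgM; [exact: cr|exact: cM].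
    by apply: cvgD; apply: cvgM; (exact: cr || exact: cM).
  apply/funext => sq; rewrite /= mxE !big_ord_recl big_ord0 addr0.
  by congr (_ * _ + (_ * _ + _ * _)); congr (_ _ _); apply/val_inj.
Qed.

(** A one-parameter subgroup is the orbit of the identity under its own left translations, and
    [t - s] carries the point at [s] to the point at [t]. *)
Lemma homogeneous_one_parameter (f : R -> V) : continuous f ->
  se2 (f 0) = se2 (0, 0, 0) ->
  (forall s t, se2 (f (s + t)) = se2 (se2_mul (f s) (f t))) ->
  homogeneous [set se2 (f t) | t in [set: R]].
Proof.
move=> cf f0 fD; exists (fun s => translate (f s)); split.
- exact: one_parameter_translate.
- move=> s _ [_ [t _ <-] <-]; exists (s + t) => //.
  by rewrite translate_se2 fD.
- move=> _ _ [s _ <-] [t _ <-]; exists (t - s).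
  by rewrite translate_se2 -fD subrK.
Qed.

Lemma continuous_pair (T U W : topologicalType) (f : T -> U) (g : T -> W) :
  continuous f -> continuous g -> continuous (fun x => (f x, g x)).
Proof. by move=> cf cg x; exact: (cvg_pair (cf x) (cg x)). Qed.

Lemma homogeneous_forward : homogeneous [set se2 (t, 0, 0) | t in [set: R]].
Proof.
apply: (homogeneous_one_parameter (f := fun t => (t, 0, 0))) => //.
- by apply: continuous_pair; [apply: continuous_pair|]; move=> t; (exact: cvg_id || exact: cvg_cst).
- move=> s t; apply/se2_eqP.
  by rewrite /se2_mul /= cos0 sin0 !mul1r !mul0r subr0 !addr0 cos0 sin0.
Qed.

Lemma homogeneous_turning : homogeneous [set se2 (0, 0, t) | t in [set: R]].
Proof.
apply: (homogeneous_one_parameter (f := fun t => (0, 0, t))) => //.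
- by apply: continuous_pair => t; (exact: cvg_id || exact: cvg_cst).
- by move=> s t; apply/se2_eqP; rewrite /se2_mul /= !mulr0 subr0 !addr0.
Qed.

End LeftTranslations.

Theorem mainTheorem1 (R : realType) :
  (forall g : R -> SE2 R, arclength_geodesic g -> g 0 = se2 (0, 0, 0) ->
     (homogeneous (range g) <->
        range g = [set se2 (t, 0, 0) | t in [set: R]] \/
        range g = [set se2 (0, 0, t) | t in [set: R]]))
  /\ ~ geodesically_orbital R.
Proof.
have main (g : R -> SE2 R) : arclength_geodesic g -> g 0 = se2 (0, 0, 0) ->
    (homogeneous (range g) <->
       range g = [set se2 (t, 0, 0) | t in [set: R]] \/
       range g = [set se2 (0, 0, t) | t in [set: R]]).
  move=> geo g0; split; first exact: homogeneous_geodesic_image.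
  by case=> ->; [exact: homogeneous_forward|exact: homogeneous_turning].
split => // orb.
have geo := @tractrix_geodesic R.
have [t yt] := @tractrix_leaves_axis R; move/eqP: yt; apply.
have hom : homogeneous (range (@tractrix R)) by apply: orb; exists 1.
have : range (@tractrix R) (tractrix t) by exists t.
by case: (main _ geo tractrix0) => /(_ hom)[] -> _ [s _ <-]; rewrite se2E !mxE.
Qed.
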